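(* Let $P\subset\mathbb{R}^n$ be a polytope with $v$ vertices and let $S_M\in\mathbb{R}^{f\times v}_+$ be its slack matrix, of rank $r$ (i.e. $P$ has dimension $r-1$). Let $r_+=\operatorname{rank}_+(S_M)$. Then $$v\;\le\;\phi(r,r_+)=\phi_r(r_+)\;\le\;\max_{r\le r_u\le r_+}\binom{r_+}{r_u-r+1}\;\le\;\binom{r_+}{\lfloor r_+/2\rfloor}\;\le\;2^{r_+}.$$ Therefore, the minimum size $s$ of any extended formulation of $P$ satisfies $$s=\Theta(r_++n)\;\ge\;\Theta\big(\phi_r^{-1}(v)\big)\;\ge\;\Theta(\log_2(v)),$$ where $\phi_r^{-1}$ is the inverse of the nondecreasing function $\phi_r(\cdot)=\phi(r,\cdot)$.
   Context: For a nonnegative matrix $M\in\mathbb{R}^{m\times n}_+$, the nonnegative rank $\operatorname{rank}_+(M)$ is the minimum $k$ such that $M=UV$ for some entrywise nonnegative $U\in\mathbb{R}^{m\times k}_+$, $V\in\mathbb{R}^{k\times n}_+$. Slack matrix: if $P=\{x\in\mathbb{R}^n\mid Cx\ge d,\ Ax=b\}$ is a polytope, with $C$ having $f$ rows, and $v_1,\dots,v_v$ are its vertices, the slack matrix $S_M\in\mathbb{R}^{f\times v}_+$ has columns $S_M(:,i)=Cv_i-d\ge 0$. Extended formulation: a polyhedron $Q\subset\mathbb{R}^{n+p}$ such that $P=\{x\in\mathbb{R}^n\mid \exists y\in\mathbb{R}^p \text{ with }(x,y)\in Q\}$. Its size is the number of constraints plus the number of variables defining $Q$. $\operatorname{faces}(n,d,k)$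 is the maximal number of $k$-faces ($k$-dimensional faces) of a $d$-dimensional polytope with $n$ vertices, and $$\phi(r,r_+)=\max_{r\le r_u\le r_+}\operatorname{faces}(r_+,r_u-1,r_u-r),$$ the maximum being over integers $r_u$; for fixed $r$, it is nondecreasing in $r_+$. As $\phi_r$ is a function on integers, $\phi_r^{-1}(v)$ is understood as the smallest integer $k$ with $\phi_r(k)\ge v$. *)

(* Defs.v *)
From HB Require Import structures.
From mathcomp Require Import all_boot all_order all_algebra.
From mathcomp Require Import boolp classical_sets cardinality reals exp.

Set Implicit Arguments.
Unset Strict Implicit.
Unset Printing Implicit Defensive.

Import Order.TTheory GRing.Theory Num.Theory.

Local Open Scope classical_set_scope.
Local Open Scope card_scope.
Local Open Scope ring_scope.

(* Greatest and least element of a set of naturals; both default to 0 when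
   there is no such element. *)
Definition nat_max (A : set nat) : nat :=
  xget 0%N [set m | A m /\ forall k, A k -> (k <= m)%N].

Definition nat_min (A : set nat) : nat :=
  xget 0%N [set m | A m /\ forall k, A k -> (m <= k)%N].

Definition nonneg_mx (R : realType) (m n : nat) (M : 'M[R]_(m, n)) : Prop :=
  forall i j, 0 <= M i j.

Definition nonneg_rank (R : realType) (m n : nat) (M : 'M[R]_(m, n)) : nat :=
  nat_min [set k | exists (U : 'M[R]_(m, k)) (V : 'M[R]_(k, n)),
    [/\ nonneg_mx U, nonneg_mx V & M = U *m V]].

Definition polyhedron (R : realType) (n f m : nat)
    (C : 'M[R]_(f, n)) (d : 'cV[R]_f) (A : 'M[R]_(m, n)) (b : 'cV[R]_m) :
    set 'cV[R]_n :=
  [set x | (forall i, d i 0 <= (C *m x) i 0) /\ A *m x = b].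

Definition is_bounded (R : realType) (n : nat) (P : set 'cV[R]_n) : Prop :=
  exists B : R, forall x, P x -> forall i, `|x i 0| <= B.

Definition is_polytope (R : realType) (n : nat) (P : set 'cV[R]_n) : Prop :=
  is_bounded P /\
  exists (f m : nat) (C : 'M[R]_(f, n)) (d : 'cV[R]_f)
         (A : 'M[R]_(m, n)) (b : 'cV[R]_m), P = polyhedron C d A b.

(* Dimension of the affine hull of P, computed as the dimension of its
   direction: the smallest linear subspace containing all differences of
   points of P.  The value on the empty set is 0, not -1. *)
Definition affdim (R : realType) (n : nat) (P : set 'cV[R]_n) : nat :=
  nat_min [set k | exists2 W : {vspace 'cV[R]_n},
    \dim W = k & forall x y, P x -> P y -> x - y \in W].

(* The case c = 0 makes P itself and the empty set faces of P. *)
Definition is_face (R : realType) (n : nat) (P F : set 'cV[R]_n) : Prop :=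
  exists (c : 'rV[R]_n) (g : R),
    (forall x, P x -> (c *m x) 0 0 <= g) /\
    F = P `&` [set x | (c *m x) 0 0 = g].

Definition kfaces (R : realType) (n : nat) (P : set 'cV[R]_n) (k : nat) :
    set (set 'cV[R]_n) :=
  [set F | [/\ is_face P F, F !=set0 & affdim F = k]].

Definition vertices (R : realType) (n : nat) (P : set 'cV[R]_n) :
    set 'cV[R]_n :=
  [set x | is_face P [set x]].

(* The polytope Q may live in a space of any dimension N. *)
Definition faces (R : realType) (n d k : nat) : nat :=
  nat_max [set c | exists (N : nat) (Q : set 'cV[R]_N),
    [/\ is_polytope Q, affdim Q = d, vertices Q #= `I_n & kfaces Q k #= `I_c]].

(* For r >= 1 the truncated subtractions are exact on the range of ru; the
   value is 0 when rp < r. *)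
Definition phi (R : realType) (r rp : nat) : nat :=
  \max_(r <= ru < rp.+1) faces R rp ru.-1 (ru - r).

Definition phi_inv (R : realType) (r v : nat) : nat :=
  nat_min [set k | (v <= phi R r k)%N].

(* The columns of V list the elements of the set A without repetition. *)
Definition enumerates (R : realType) (n v : nat) (A : set 'cV[R]_n)
    (V : 'M[R]_(n, v)) : Prop :=
  injective (fun j => col j V) /\
  A = [set x | exists j, x = col j V].

Definition slack_matrix (R : realType) (n f v : nat)
    (C : 'M[R]_(f, n)) (d : 'cV[R]_f) (V : 'M[R]_(n, v)) : 'M[R]_(f, v) :=
  \matrix_(i, j) ((C *m col j V) i 0 - d i 0).

(* Sizes of the extended formulations of P.  The formulation has q
   inequalities, e equations and the n + p variables (x, y). *)
Definition ext_sizes (R : realType) (n : nat) (P : set 'cV[R]_n) : set nat :=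
  [set s | exists (p q e : nat) (G : 'M[R]_(q, n + p)) (h : 'cV[R]_q)
                  (E : 'M[R]_(e, n + p)) (g : 'cV[R]_e),
    P = [set x | exists y : 'cV[R]_p, polyhedron G h E g (col_mx x y)] /\
    s = ((q + e) + (n + p))%N].

Definition ext_complexity (R : realType) (n : nat) (P : set 'cV[R]_n) : nat :=
  nat_min (ext_sizes P).

Definition log2 (R : realType) (x : R) : R := ln x / ln 2.

(* Main.v *)
(* Minkowski-Weyl duality for cones (by double description) gives Farkas' lemma
   and identifies a bounded polyhedron with the convex hull of its vertices.

   Let S = U W be a minimal nonnegative factorization with the columns of U
   summing to 1.  By minimality these columns are exactly the rank_+(S) vertices
   of a polytope T of dimension rank U - 1, and P is, up to a projective
   transformation, the section of T by the column space L of S.  Descending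
   through faces of T, each vertex w of P is put on a face of T of dimension
   rank U - rank S which meets L only in the line spanned by w; this gives the
   first inequality.  A k-face of T is determined by k + 1 affinely independent
   vertices, which gives the binomial bound.

   For the size s of an extension of P, Farkas' lemma gives rank_+(S) <= 2 s, and
   the extension {(x, y) | y >= 0, C x - d = U y, A x = b} gives
   s <= 3 (rank_+(S) + n). *)
Require Import Defs.
From HB Require Import structures.
From mathcomp Require Import all_boot all_order all_algebra.
From mathcomp Require Import boolp classical_sets cardinality reals exp.
From mathcomp Require Import zify lra.

Set Implicit Arguments.
Unset Strict Implicit.
Unset Printing Implicit Defensive.

Import Order.TTheory GRing.Theory Num.Theory.

Local Open Scope classical_set_scope.
Local Open Scope ring_scope.

(** * Finitely generated cones *)

(** Everything is done with cones: appending a coordinate equal to 1 ([lift1]) turns convex hulls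
    into slices of cones and affine dimension into linear dimension minus one. Normalizing the
    columns of U to sum 1 serves the same end: T then lies in an affine hyperplane missing 0, so its
    faces correspond to those of its cone. The delicate point is the dimension of the face chosen
    for w. The smallest face of T through w meets L only along w, but its dimension may be too
    small. So a face is shrunk under the constraint that its span and L together still fill the span
    of U; once it meets L only in the line of w, the dimension formula gives exactly rank U - rank
    S. Distinct vertices then get distinct faces, because no two columns of S are proportional. The
    binomial bound also serves the first inequality: it makes the maximum in [faces] exist, where
    otherwise the default value 0 could stand. *)

Lemma nonneg_mx0 (R : realType) m n : nonneg_mx (0 : 'M[R]_(m, n)).
Proof. by move=> i j; rewrite mxE. Qed.

Lemma nonneg_mxD (R : realType) m n (A B : 'M[R]_(m, n)) :
  nonneg_mx A -> nonneg_mx B -> nonneg_mx (A + B).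
Proof. by move=> A0 B0 i j; rewrite mxE addr_ge0. Qed.

Lemma nonneg_mxM (R : realType) m n p (A : 'M[R]_(m, n)) (B : 'M[R]_(n, p)) :
  nonneg_mx A -> nonneg_mx B -> nonneg_mx (A *m B).
Proof. by move=> A0 B0 i j; rewrite mxE sumr_ge0// => k _; exact: mulr_ge0. Qed.

Lemma row_mulE (R : realType) m n p (A : 'M[R]_(m, n)) (B : 'M[R]_(n, p)) i j :
  (row i A *m B) 0 j = (A *m B) i j.
Proof. by rewrite -row_mul mxE. Qed.

Lemma mul_colE (R : realType) m n p (A : 'M[R]_(m, n)) (B : 'M[R]_(n, p)) i j :
  (A *m col j B) i 0 = (A *m B) i j.
Proof. by rewrite colE mulmxA -colE mxE. Qed.

Lemma nonneg_mxZ (R : realType) m n a (A : 'M[R]_(m, n)) :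
  0 <= a -> nonneg_mx A -> nonneg_mx (a *: A).
Proof. by move=> a0 A0 i j; rewrite mxE; apply: mulr_ge0. Qed.

Lemma nonneg_mxT (R : realType) m n (A : 'M[R]_(m, n)) :
  nonneg_mx A -> nonneg_mx A^T.
Proof. by move=> A0 i j; rewrite mxE; exact: A0. Qed.

Lemma nonneg_col (R : realType) m n (A : 'M[R]_(m, n)) j :
  nonneg_mx A -> nonneg_mx (col j A).
Proof. by move=> A0 i k; rewrite mxE; exact: A0. Qed.

Lemma nonneg_delta_mx (R : realType) m n i j : nonneg_mx (delta_mx i j : 'M[R]_(m, n)).
Proof. by move=> a b; rewrite mxE; case: andP => _; rewrite ?ler01 ?lexx. Qed.

Lemma nonneg_col_mx (R : realType) m1 m2 n (A : 'M[R]_(m1, n)) (B : 'M[R]_(m2, n)) :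
  nonneg_mx (col_mx A B) <-> nonneg_mx A /\ nonneg_mx B.
Proof.
split=> [AB0|[A0 B0] i j].
  split=> i j; first by have := AB0 (lshift _ i) j; rewrite col_mxEu.
  by have := AB0 (rshift _ i) j; rewrite col_mxEd.
by case: (split_ordP i) => k ->; rewrite ?col_mxEu ?col_mxEd.
Qed.

Definition cone (R : realType) N k (G : 'M[R]_(N, k)) : set 'cV[R]_N :=
  [set x | exists2 l : 'cV[R]_k, nonneg_mx l & x = G *m l].

Lemma cone_col (R : realType) N k (G : 'M[R]_(N, k)) j : cone G (col j G).
Proof. by exists (delta_mx j 0); [exact: nonneg_delta_mx | rewrite -colE]. Qed.

Lemma exists_between (R : realType) (lo up : seq R) :
  (forall a b, a \in lo -> b \in up -> a <= b) ->
  exists t, (forall a, a \in lo -> a <= t) /\ (forall b, b \in up -> t <= b).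
Proof.
elim: lo => [|a lo IH] lu.
  elim: up {lu} => [|b up [t [_ tu]]]; first by exists 0.
  exists (Num.min b t); split=> // c; rewrite inE => /orP[/eqP->|/tu].
    by rewrite ge_min lexx.
  by rewrite ge_min => ->; rewrite orbT.
have [t [lt tu]] := IH (fun x y xl => lu x y (mem_behead (s := a :: lo) xl)).
exists (Num.max a t); split=> [c|b bu]; last by rewrite ge_max tu// lu// mem_head.
rewrite inE => /orP[/eqP->|/lt]; first by rewrite le_max lexx.
by rewrite le_max => ->; rewrite orbT.
Qed.

(* Adding a generator amounts to eliminating its coefficient t by
   Fourier-Motzkin. *)
Lemma weyl_seq (R : realType) N k (G : 'M[R]_(N, k)) :
  exists B : seq 'rV[R]_N,
    forall x, cone G x <-> (forall b, b \in B -> 0 <= (b *m x) 0 0).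
Proof.
elim: k G => [|k IH] G.
  exists ([seq delta_mx 0 i | i : 'I_N] ++ [seq - delta_mx 0 i | i : 'I_N]) => x; split.
    move=> [l _ ->] b _; rewrite [l]flatmx0 !mulmx0 mxE; exact: lexx.
  move=> xB; exists 0; rewrite ?mulmx0//; first exact: nonneg_mx0.
  apply/colP => i; rewrite mxE; apply/eqP; rewrite eq_le.
  have := xB (delta_mx 0 i); have := xB (- delta_mx 0 i).
  rewrite !mem_cat mulNmx -rowE !mxE oppr_ge0.
  have -> : (- delta_mx 0 i : 'rV[R]_N) \in [seq - delta_mx 0 i | i : 'I_N].
    by rewrite (map_f (fun j => - delta_mx 0 j : 'rV[R]_N)) ?mem_enum.
  have -> : (delta_mx 0 i : 'rV[R]_N) \in [seq delta_mx 0 i | i : 'I_N].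
    by rewrite (map_f (fun j => delta_mx 0 j : 'rV[R]_N)) ?mem_enum.
  by rewrite orbT => /(_ isT)-> /(_ isT)->.
move: G; rewrite -[k.+1]/(1 + k)%N => G.
have [B BP] := IH (rsubmx G); pose g := lsubmx G; pose e (b : 'rV[R]_N) := (b *m g) 0 0.
(* The first list keeps the functionals that do not involve t and compares the lower bound t >= 0
   with the upper bounds. The second one consists of positive combinations vanishing at [g], which
   compare the other lower bounds with the upper ones. *)
exists ([seq b <- B | 0 <= e b] ++
  [seq e b2 *: b1 - e b1 *: b2 | b1 <- [seq b <- B | e b < 0], b2 <- [seq b <- B | 0 < e b]]).
move=> x.
have eq1 : cone G x <-> exists2 t, 0 <= t & cone (rsubmx G) (x - t *: g).
  split=> [[l l0 ->]|[t t0 [l l0 xE]]].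
    exists (l 0 0) => //; exists (dsubmx l).
      by move=> i j; rewrite !mxE.
    rewrite -[in G *m l](hsubmxK G) -[in _ *m l](vsubmxK l) mul_row_col.
    have -> : usubmx l = (l 0 0)%:M.
      by apply/matrixP => i j; rewrite !ord1 !mxE eqxx mulr1n; congr (l _ _); apply/val_inj.
    by rewrite mul_mx_scalar -/g addrC addKr.
  exists (col_mx t%:M l).
    by apply/nonneg_col_mx; split=> // i j; rewrite !ord1 mxE eqxx.
  by rewrite -(hsubmxK G) mul_row_col mul_mx_scalar -xE addrC subrK.
have exE t b : (b *m (x - t *: g)) 0 0 = (b *m x) 0 0 - t * e b.
  by rewrite /e mulmxBr -scalemxAr !mxE.
have eB a1 a2 (b1 b2 : 'rV[R]_N) :
    ((a1 *: b1 - a2 *: b2) *m x) 0 0 = a1 * (b1 *m x) 0 0 - a2 * (b2 *m x) 0 0.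
  by rewrite mulmxBl -!scalemxAl !mxE.
apply: (iff_trans eq1); split.
  move=> [t t0 /BP xB] b; rewrite mem_cat => /orP[|].
    rewrite mem_filter => /andP[eb bB]; have := xB _ bB; rewrite exE.
    by rewrite subr_ge0; apply: le_trans; rewrite mulr_ge0.
  case/allpairsP => -[b1 b2] /= []; rewrite !mem_filter => /andP[e1 b1B] /andP[e2 b2B] ->.
  have := xB _ b1B; have := xB _ b2B; rewrite !exE => x2 x1.
  rewrite eB; nra.
move=> xB.
have [t [lt tu]] : exists t,
    (forall a, a \in 0 :: [seq (b *m x) 0 0 / e b | b <- B & e b < 0] -> a <= t)
    /\ (forall a, a \in [seq (b *m x) 0 0 / e b | b <- B & 0 < e b] -> t <= a).
  apply: exists_between => a c; rewrite inE => /orP[/eqP->|].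
    move=> /mapP[b]; rewrite mem_filter => /andP[eb bB] ->.
    apply: divr_ge0; last exact: ltW.
    by apply: xB; rewrite mem_cat mem_filter ltW// bB.
  move=> /mapP[b1]; rewrite mem_filter => /andP[e1 b1B] ->.
  move=> /mapP[b2]; rewrite mem_filter => /andP[e2 b2B] ->.
  have := xB (e b2 *: b1 - e b1 *: b2); rewrite mem_cat.
  rewrite (@allpairs_f _ _ _ (fun b1 b2 => e b2 *: b1 - e b1 *: b2)) ?mem_filter ?e1 ?e2// orbT.
  move=> /(_ isT); rewrite eB => h.
  rewrite ler_pdivlMr// mulrAC ler_ndivrMr// ; nra.
exists t; first by apply: lt; rewrite mem_head.
apply/BP => b bB; rewrite exE subr_ge0; case: (ltgtP (e b) 0) => eb.
- rewrite -ler_ndivrMr//; apply: lt; rewrite inE; apply/orP; right.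
  by apply: map_f; rewrite mem_filter eb.
- by rewrite -ler_pdivlMr//; apply: tu; apply: map_f; rewrite mem_filter eb.
- by rewrite eb mulr0 xB// mem_cat mem_filter eb lexx bB.
Qed.

Lemma weyl (R : realType) N k (G : 'M[R]_(N, k)) :
  exists q (B : 'M[R]_(q, N)), forall x, cone G x <-> nonneg_mx (B *m x).
Proof.
have [B BP] := weyl_seq G; exists (size B), (\matrix_i nth 0 B i) => x.
have E i : ((\matrix_i nth 0 B i) *m x) i 0 = ((nth 0 B i) *m x) 0 0.
  by rewrite -row_mulE rowK.
apply: (iff_trans (BP x)); split=> [h i j|h b bB].
  by rewrite ord1 E; apply/h/mem_nth.
rewrite -(nth_index 0 bB); have ib : (index b B < size B)%N by rewrite index_mem.
by have := h (Ordinal ib) 0; rewrite E.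
Qed.

(** By [weyl] the cone of the rows of [H] is cut out by finitely many functionals; each of them,
    read as a vector y, satisfies H y >= 0, so [c] lies in that cone. *)
Lemma farkas (R : realType) N k (H : 'M[R]_(k, N)) (c : 'rV[R]_N) :
  (forall y : 'cV_N, nonneg_mx (H *m y) -> 0 <= (c *m y) 0 0) ->
  exists2 l : 'rV[R]_k, nonneg_mx l & c = l *m H.
Proof.
move=> Hc; have [q [B BP]] := weyl H^T.
suff [l l0 cE] : cone H^T c^T.
  by exists l^T; [exact: nonneg_mxT | rewrite -[c]trmxK cE trmx_mul trmxK].
apply/BP => i j; rewrite ord1 -[_ *m _]trmxK trmx_mul trmxK mxE.
rewrite -mul_colE.
apply: Hc => a b; rewrite ord1 colE mulmxA -colE mxE.
have := (BP (col a H^T)).1 (cone_col _ _) i 0.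
by rewrite !mxE; congr (0 <= _); apply: eq_bigr => t _; rewrite !mxE mulrC.
Qed.

(** The generators are the functionals [D] cutting out the cone of the rows of [B]. A second use of
    [weyl], on the cone they generate, gives functionals nonnegative on them, hence nonnegative
    combinations of rows of [B]. *)
Lemma minkowski_cone (R : realType) N q (B : 'M[R]_(q, N)) :
  exists k (G : 'M[R]_(N, k)), forall x, nonneg_mx (B *m x) <-> cone G x.
Proof.
have [k [D DP]] := weyl B^T; exists k, D^T => x; split; last first.
  move=> [l l0 ->]; rewrite mulmxA; apply: nonneg_mxM => // i j.
  have := (DP (col i B^T)).1 (cone_col _ _) j 0.
  by rewrite !mxE; congr (0 <= _); apply: eq_bigr => t _; rewrite !mxE mulrC.
have [q' [B' B'P]] := weyl D^T.
move=> Bx; apply/B'P => i j; rewrite ord1.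
have /DP[l l0 E] : nonneg_mx (D *m (row i B')^T).
  move=> a b; rewrite ord1; have := (B'P (col a D^T)).1 (cone_col _ _) i 0.
  by rewrite !mxE; congr (0 <= _); apply: eq_bigr => t _; rewrite !mxE mulrC.
rewrite -row_mulE.
rewrite -[row i B']trmxK E trmx_mul trmxK -mulmxA.
by apply: nonneg_mxM => //; exact: nonneg_mxT.
Qed.

(** * Polytopes as convex hulls *)

Definition conv (R : realType) N k (p : 'M[R]_(N, k)) : set 'cV[R]_N :=
  [set x | exists l : 'cV[R]_k,
    [/\ nonneg_mx l, \sum_j l j 0 = 1 & x = p *m l]].

(** Homogenization at height 1; the height is the last coordinate. *)
Definition lift1 (R : realType) N k (p : 'M[R]_(N, k)) : 'M[R]_(N + 1, k) :=
  col_mx p (const_mx 1).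

Lemma col_lift1 (R : realType) N k (p : 'M[R]_(N, k)) j :
  col j (lift1 p) = lift1 (col j p).
Proof. by rewrite /lift1 col_col_mx col_const. Qed.

Lemma const_mul (R : realType) k (l : 'cV[R]_k) :
  const_mx 1 *m l = const_mx (\sum_j l j 0) :> 'cV_1.
Proof.
by apply/matrixP => i j; rewrite !ord1 !mxE; apply: eq_bigr => t _; rewrite mxE mul1r.
Qed.

Lemma lift1_mul (R : realType) N k (p : 'M[R]_(N, k)) (l : 'cV[R]_k) :
  lift1 p *m l = col_mx (p *m l) (const_mx (\sum_j l j 0)).
Proof. by rewrite /lift1 mul_col_mx const_mul. Qed.

Lemma convE (R : realType) N k (p : 'M[R]_(N, k)) x :
  conv p x <-> cone (lift1 p) (lift1 x).
Proof.
split=> [[l [l0 l1 ->]]|[l l0]]; first by exists l => //; rewrite lift1_mul l1.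
rewrite lift1_mul => /eq_col_mx[xE /matrixP/(_ 0 0)]; rewrite !mxE => sl.
by exists l.
Qed.

Lemma conv_col (R : realType) N k (p : 'M[R]_(N, k)) j : conv p (col j p).
Proof. by rewrite convE -col_lift1; exact: cone_col. Qed.

Lemma conv_bounded (R : realType) N k (p : 'M[R]_(N, k)) : is_bounded (conv p).
Proof.
exists (\sum_i \sum_j `|p i j|) => x [l [l0 l1 ->]] i; rewrite mxE.
apply: le_trans (ler_norm_sum _ _ _) _; rewrite (bigD1 i)//=.
rewrite -[leLHS]addr0; apply: lerD; last by apply: sumr_ge0 => a _; exact: sumr_ge0.
apply: ler_sum => j _; rewrite normrM -[leRHS]mulr1 ler_wpM2l// ger0_norm//.
rewrite -l1 (bigD1 j)//= lerDl; exact: sumr_ge0.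
Qed.

Lemma conv_polyhedron (R : realType) N k (p : 'M[R]_(N, k)) :
  exists (f m : nat) (C : 'M[R]_(f, N)) (d : 'cV[R]_f) (A : 'M[R]_(m, N)) (b : 'cV[R]_m),
    conv p = polyhedron C d A b.
Proof.
have [q [B BP]] := weyl (lift1 p).
exists q, 0, (lsubmx B), (- rsubmx B), 0, 0; apply/seteqP; split=> x.
  move=> /convE/BP h; split=> [i|]; last by rewrite mul0mx.
  have := h i 0; rewrite -[B]hsubmxK mul_row_col !hsubmxK !mxE.
  rewrite big_ord1 !mxE mulr1 -[0 <= _]subr_ge0.
  by rewrite subr0 addrC -[X in 0 <= X + _]opprK addrC subr_ge0.
move=> [h _]; apply/convE/BP => i j; rewrite ord1.
have := h i; rewrite -[in X in _ -> 0 <= X](hsubmxK B) mul_row_col !mxE.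
by rewrite big_ord1 !mxE mulr1 -subr_ge0 opprK.
Qed.

Lemma conv_is_polytope (R : realType) N k (p : 'M[R]_(N, k)) : is_polytope (conv p).
Proof. by split; [exact: conv_bounded | exact: conv_polyhedron]. Qed.

(** Each equation becomes two opposite inequalities and the last row says t >= 0. The doubled
    equations account for the factor 2 in the bound of the nonnegative rank by the size of an
    extension. *)
Lemma homogenize (R : realType) (n f m : nat)
    (C : 'M[R]_(f, n)) (d : 'cV[R]_f) (A : 'M[R]_(m, n)) (b : 'cV[R]_m) :
  exists H : 'M[R]_(f + (m + (m + 1)), n + 1), forall (x : 'cV[R]_n) t,
    nonneg_mx (H *m col_mx x (const_mx t)) <->
    [/\ forall i, t * d i 0 <= (C *m x) i 0, A *m x = t *: b & 0 <= t].
Proof.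
exists (col_mx (row_mx C (- d))
  (col_mx (row_mx A (- b)) (col_mx (row_mx (- A) b) (row_mx 0 1%:M)))) => x t.
have tE k (v : 'cV[R]_k) : v *m (const_mx t : 'cV[R]_1) = t *: v.
  by apply/matrixP => i j; rewrite !ord1 !mxE big_ord1 mxE mulrC.
rewrite !mul_col_mx !mul_row_col !nonneg_col_mx !tE mul0mx add0r.
split=> [[h1 [h2 [h3 h4]]]|[h1 h2 h3]].
  split; last by have := h4 0 0; rewrite !mxE eqxx mulr1.
    move=> i; have := h1 i 0; rewrite scalerN [X in 0 <= X]mxE [X in _ + X]mxE.
    by rewrite [X in _ - X]mxE subr_ge0.
  apply/colP => i; apply/eqP; rewrite eq_le; have := h2 i 0; have := h3 i 0.
  rewrite mulNmx [X in 0 <= X]mxE [X in X + _]mxE addrC subr_ge0 => ->.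
  by rewrite [X in 0 <= X]mxE scalerN [X in _ + X]mxE subr_ge0 => ->.
split.
  by move=> i j; rewrite ord1 scalerN [X in 0 <= X]mxE [X in _ + X]mxE [X in _ - X]mxE subr_ge0.
rewrite mulNmx scalerN h2 subrr addNr; split; first exact: nonneg_mx0.
by split; [exact: nonneg_mx0 | move=> i j; rewrite !ord1 !mxE eqxx mulr1].
Qed.

Lemma polyhedron_hom (R : realType) (n f m : nat)
    (C : 'M[R]_(f, n)) (d : 'cV[R]_f) (A : 'M[R]_(m, n)) (b : 'cV[R]_m) q (H : 'M[R]_(q, n + 1)) :
  (forall (x : 'cV[R]_n) t, nonneg_mx (H *m col_mx x (const_mx t)) <->
    [/\ forall i, t * d i 0 <= (C *m x) i 0, A *m x = t *: b & 0 <= t]) ->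
  forall x, polyhedron C d A b x <-> nonneg_mx (H *m lift1 x).
Proof.
move=> HP x; rewrite HP; split=> [[h1 h2]|[h1 h2 _]].
  by rewrite scale1r; split=> // i; rewrite mul1r.
by rewrite -[b]scale1r; split=> // i; rewrite -[d i 0]mul1r.
Qed.

Lemma bounded_recession (R : realType) (n f m : nat)
    (C : 'M[R]_(f, n)) (d : 'cV[R]_f) (A : 'M[R]_(m, n)) (b : 'cV[R]_m) (x y : 'cV[R]_n) :
  is_bounded (polyhedron C d A b) -> polyhedron C d A b x ->
  (forall i, 0 <= (C *m y) i 0) -> A *m y = 0 -> y = 0.
Proof.
move=> [B PB] [Cx Ax] Cy Ay; apply/colP => i; rewrite mxE; apply/eqP/negPn/negP => yi.
have Px a : 0 <= a -> polyhedron C d A b (x + a *: y).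
  move=> a0; split; last by rewrite mulmxDr -scalemxAr Ay scaler0 addr0.
  move=> j; rewrite mulmxDr -scalemxAr mxE [X in _ + X]mxE.
  by rewrite -[d j 0]addr0 lerD// mulr_ge0.
have yi0 : 0 < `|y i 0| by rewrite normr_gt0.
have B0 : 0 <= B by apply: le_trans (PB _ (Px 0 (lexx 0)) i).
(* This multiple of [y] moves coordinate [i] by B + |x_i| + 1, hence out of the box of size [B]. *)
have a0 : 0 <= (B + `|x i 0| + 1) / `|y i 0| by rewrite divr_ge0// !addr_ge0.
have := PB _ (Px _ a0) i; rewrite mxE [X in _ + X]mxE.
have := ler_normD (x i 0 + (B + `|x i 0| + 1) / `|y i 0| * y i 0) (- x i 0).
rewrite addrAC subrr add0r normrM (ger0_norm a0) divfK ?gt_eqF// normrN; lra.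
Qed.

Lemma polyhedron_conv (R : realType) (n f m k : nat)
    (C : 'M[R]_(f, n)) (d : 'cV[R]_f) (A : 'M[R]_(m, n)) (b : 'cV[R]_m) (p : 'M[R]_(n, k)) :
  (forall j, polyhedron C d A b (col j p)) -> conv p `<=` polyhedron C d A b.
Proof.
move=> Pp x /convE[l l0 xE].
have [H HP] := homogenize C d A b; apply/(polyhedron_hom HP).
rewrite xE mulmxA; apply: nonneg_mxM => // i j; rewrite -mul_colE col_lift1.
by move/(polyhedron_hom HP): (Pp j); exact.
Qed.

(** Generators of the homogenized cone at positive height rescale to points of the polyhedron; those
    at height 0 are recession directions, which vanish by boundedness. *)
Lemma bounded_polyhedron_conv (R : realType) (n f m : nat)
    (C : 'M[R]_(f, n)) (d : 'cV[R]_f) (A : 'M[R]_(m, n)) (b : 'cV[R]_m) :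
  is_bounded (polyhedron C d A b) ->
  exists k (p : 'M[R]_(n, k)), polyhedron C d A b = conv p.
Proof.
move=> Pb; have [[x0 Px0]|P0] := pselect (polyhedron C d A b !=set0); last first.
  exists 0, 0; apply/seteqP; split=> x; first by move=> Px; case: P0; exists x.
  by move=> [l []]; rewrite big_ord0 => _ /eqP; rewrite eq_sym oner_eq0.
have [H HP] := homogenize C d A b; have [k [G GP]] := minkowski_cone H.
pose t j := G (rshift n 0) j; pose y j := col j (usubmx G).
have GE j : col j G = col_mx (y j) (const_mx (t j)).
  rewrite -[in LHS](vsubmxK G) col_col_mx; congr col_mx.
  by apply/colP => i; rewrite ord1 !mxE; congr (G _ _); apply: val_inj.
have Ht j : [/\ forall i, t j * d i 0 <= (C *m y j) i 0, A *m y j = t j *: b & 0 <= t j].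
  by apply/HP; rewrite -GE; apply/GP/cone_col.
(* A generator at height 0 is 0, so [x0] is only a placeholder inside the polyhedron. *)
pose pc j := if t j == 0 then x0 else (t j)^-1 *: y j.
pose p := \matrix_(i, j) pc j i 0.
have pE j : col j p = pc j by apply/colP => i; rewrite !mxE.
have yE j : y j = t j *: pc j.
  rewrite /pc; case: eqVneq => [t0|t0]; last by rewrite scalerA divff ?scale1r.
  rewrite t0 scale0r; have [h1 h2 _] := Ht j.
  apply: (bounded_recession Pb Px0); last by rewrite h2 t0 scale0r.
  by move=> i; rewrite (le_trans _ (h1 i))// t0 mul0r.
have Pp j : polyhedron C d A b (col j p).
  rewrite pE /pc; case: eqVneq => // tj; have [h1 h2 h3] := Ht j.
  have tj0 : 0 < t j by rewrite lt_def tj.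
  split=> [i|]; last by rewrite -scalemxAr h2 scalerA mulVf ?scale1r.
  by rewrite -scalemxAr mxE mulrC ler_pdivlMr// mulrC.
exists k, p; apply/seteqP; split; last exact: polyhedron_conv.
move=> x /(polyhedron_hom HP)/GP[l l0 xE].
have sE : \sum_j t j * l j 0 = 1.
  by have /colP/(_ (rshift n 0)) := xE; rewrite col_mxEd !mxE => ->.
exists (\col_j (t j * l j 0)); split.
- by move=> i j; rewrite mxE mulr_ge0//; have [] := Ht i.
- by rewrite -[RHS]sE; apply: eq_bigr => j _; rewrite mxE.
apply/colP => i; have /colP/(_ (lshift 1 i)) := xE; rewrite col_mxEu => ->.
rewrite !mxE; apply: eq_bigr => j _; rewrite !mxE mulrA; congr (_ * _).
have /colP/(_ i) := yE j; rewrite !mxE mulrC => <-; congr (G _ _); exact: val_inj.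
Qed.

(** * Irredundant generators and vertices *)

Definition irredundant (R : realType) N k (U : 'M[R]_(N, k)) :=
  forall i (l : 'cV[R]_k), nonneg_mx l -> l i 0 = 0 -> col i U <> U *m l.

(** Row [i] of [V] is redistributed over the other rows with weights [l]. The product is unchanged
    because U kills l - e_i, and row [i] becomes 0. *)
Lemma drop_col (R : realType) N k n (U : 'M[R]_(N, k.+1)) i (l : 'cV[R]_k.+1)
    (V : 'M[R]_(k.+1, n)) :
  nonneg_mx l -> l i 0 = 0 -> col i U = U *m l -> nonneg_mx V ->
  exists2 V' : 'M[R]_(k, n), nonneg_mx V' & U *m V = col' i U *m V'.
Proof.
move=> l0 li UE V0; pose V2 := V + (l - delta_mx i 0) *m row i V.
have V2E a c : V2 a c = V a c + (l a 0 - (a == i)%:R) * V i c.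
  by rewrite !mxE big_ord1 !mxE eqxx andbT.
exists (row' i V2).
  move=> a c; rewrite mxE V2E eq_sym (negPf (neq_lift _ _)) subr0.
  by rewrite addr_ge0// mulr_ge0.
have -> : U *m V = U *m V2.
  by rewrite mulmxDr mulmxA mulmxBr -colE UE subrr mul0mx addr0.
apply/matrixP => a c; rewrite !mxE (bigD1_ord i)//= V2E eqxx li.
rewrite sub0r mulN1r subrr mulr0 add0r.
by apply: eq_bigr => j _; rewrite !mxE.
Qed.

Lemma conv_irredundant (R : realType) N k (p : 'M[R]_(N, k)) :
  exists k' (p' : 'M[R]_(N, k')), conv p = conv p' /\ irredundant (lift1 p').
Proof.
elim: k p => [|k IH] p; first by exists 0, p; split=> // -[].
have [pI|] := pselect (irredundant (lift1 p)); first by exists k.+1, p.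
move=> /existsNP[i /existsNP[l /not_implyP[l0 /not_implyP[li /contrapT E]]]].
have [k' [p' [p'E p'I]]] := IH (col' i p); exists k', p'; split=> //.
rewrite -p'E; apply/seteqP; split=> x /convE[m m0 xE]; apply/convE.
  have [m' m'0 E'] := drop_col l0 li E m0; exists m' => //.
  rewrite xE E'; congr (_ *m _); apply/matrixP => a c; rewrite !mxE.
  by case: split_ordP => j _; rewrite !mxE.
exists (\col_j (if unlift i j is Some j' then m j' 0 else 0)).
  by move=> a c; rewrite mxE; case: unliftP.
rewrite xE; apply/colP => a; rewrite !mxE [RHS](bigD1_ord i)//= !mxE unlift_none.
rewrite mulr0 add0r; apply: eq_bigr => j _; rewrite !mxE liftK.
by case: split_ordP => t _; rewrite !mxE.
Qed.

Lemma conv_functional (R : realType) N k (p : 'M[R]_(N, k)) (c : 'rV[R]_N) (g : R) (l : 'cV[R]_k) :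
  \sum_j l j 0 = 1 ->
  (c *m (p *m l)) 0 0 - g = \sum_j ((c *m p) 0 j - g) * l j 0.
Proof.
move=> l1; rewrite -[in LHS](mulr1 g) -l1 mulr_sumr mulmxA mxE -sumrB.
by apply: eq_bigr => j _; rewrite mulrBl.
Qed.

Lemma conv_supporting (R : realType) N k (p : 'M[R]_(N, k)) (c : 'rV[R]_N) (g : R) (l : 'cV[R]_k) :
  (forall j, (c *m p) 0 j <= g) -> nonneg_mx l -> \sum_j l j 0 = 1 ->
  (c *m (p *m l)) 0 0 = g -> forall j, l j 0 != 0 -> (c *m p) 0 j = g.
Proof.
move=> cg l0 l1 E j lj; have := conv_functional p c g l1; rewrite E subrr => /esym/eqP.
rewrite -oppr_eq0 -sumrN psumr_eq0 => [/allP/(_ j (mem_index_enum j))/=|i _].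
  by rewrite oppr_eq0 mulf_eq0 (negPf lj) orbF subr_eq0 => /eqP.
by rewrite -mulNr mulr_ge0// oppr_ge0 subr_le0.
Qed.

Lemma sum1_neq0 (R : realType) k (l : 'cV[R]_k) :
  \sum_j l j 0 = 1 -> exists j, l j 0 != 0.
Proof.
move=> l1; apply: contrapT => /forallNP h; have /eqP := oner_neq0 R; apply.
by rewrite -l1 big1// => j _; apply/eqP; move/negP: (h j); rewrite negbK.
Qed.

(** A lifted column outside the cone of the others is separated from it by a functional of
    [weyl_seq], whose negated linear part is maximal on the hull at that column only. Conversely, a
    one-point face contains every column with positive weight in its point. *)
Lemma irredundant_vertices (R : realType) N k (p : 'M[R]_(N, k)) :
  irredundant (lift1 p) -> enumerates (vertices (conv p)) p.
Proof.
move=> pI; split.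
  move=> i j /= ij; apply/eqP/negPn/negP => neq.
  apply: (pI i (delta_mx j 0)); first exact: nonneg_delta_mx.
    by rewrite mxE (negPf neq).
  by rewrite -colE !col_lift1 ij.
apply/seteqP; split=> x.
  move=> [c [g [cg xE]]]; have : [set x] x by [].
  rewrite xE => -[[l [l0 l1 xl]] /= cx]; have [j lj] := sum1_neq0 l1.
  have cp i : (c *m p) 0 i <= g by rewrite -mul_colE; apply/cg/conv_col.
  exists j; suff : [set x] (col j p) by move=> /= ->.
  rewrite xE; split; first exact: conv_col.
  by rewrite /= mul_colE; apply: (conv_supporting cp l0 l1) => //; rewrite -xl.
move=> [i ->] {x}; pose G0 := \matrix_(a, j) (if j == i then 0 else lift1 p a j).
have [B BP] := weyl_seq G0.
have nc : ~ cone G0 (col i (lift1 p)).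
  move=> [l l0 E]; apply: (pI i (\col_j (if j == i then 0 else l j 0))).
  - by move=> a c; rewrite mxE; case: eqP.
  - by rewrite mxE eqxx.
  rewrite E; apply/colP => a; rewrite !mxE; apply: eq_bigr => j _; rewrite !mxE.
  by case: eqP; rewrite ?mul0r ?mulr0.
have [b bB] : exists2 b, b \in B & (b *m col i (lift1 p)) 0 0 < 0.
  apply: contrapT => h; apply/nc/BP => b bB; rewrite leNgt; apply/negP => bi.
  by apply: h; exists b.
rewrite mul_colE => bi.
have bj j : j != i -> 0 <= (b *m lift1 p) 0 j.
  move=> ji; have := (BP (col j G0)).1 (cone_col _ _) b bB; rewrite mul_colE.
  by rewrite !mxE; under eq_bigr do rewrite mxE (negPf ji).
pose c := - lsubmx b; pose g := (c *m p) 0 i.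
have cE j : (c *m p) 0 j = b 0 (rshift N 0) - (b *m lift1 p) 0 j.
  rewrite -[in b *m _](hsubmxK b) mul_row_col mulNmx mxE [X in _ - X]mxE.
  by rewrite [X in _ - (_ + X)]mxE big_ord1 !mxE mulr1 opprD addrCA subrr addr0.
have cp j : (c *m p) 0 j <= g.
  rewrite /g; case: (eqVneq j i) => [->//|ji].
  by rewrite !cE lerD2l lerN2 (le_trans (ltW bi))// bj.
exists c, g; split.
  move=> x [l [l0 l1 ->]]; rewrite -subr_le0 conv_functional//.
  by apply: sumr_le0 => j _; rewrite mulr_le0_ge0// subr_le0.
apply/seteqP; split=> x.
  by move=> /= ->; split; [exact: conv_col | rewrite /= mul_colE].
move=> [[l [l0 l1 xE]] /= cx].
have lj j : j != i -> l j 0 = 0.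
  move=> ji; apply/eqP/negPn/negP => lj.
  have := conv_supporting cp l0 l1; rewrite -xE => /(_ cx j lj).
  rewrite /g !cE => /addrI/oppr_inj E.
  by have := bj j ji; rewrite E leNgt bi.
have li : l i 0 = 1 by rewrite -l1 (bigD1 i)//= big1 ?addr0.
rewrite xE; apply/colP => a; rewrite !mxE (bigD1 i)//= big1 => [|j ji].
  by rewrite li mulr1 addr0.
by rewrite lj// mulr0.
Qed.

Lemma polytope_vertices (R : realType) (n f m : nat)
    (C : 'M[R]_(f, n)) (d : 'cV[R]_f) (A : 'M[R]_(m, n)) (b : 'cV[R]_m) :
  is_bounded (polyhedron C d A b) ->
  exists k (p : 'M[R]_(n, k)), polyhedron C d A b = conv p /\ enumerates (vertices (conv p)) p.
Proof.
move=> /bounded_polyhedron_conv[k [p ->]]; have [k' [p' [-> p'I]]] := conv_irredundant p.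
by exists k', p'; split=> //; exact: irredundant_vertices.
Qed.

(** * Dimension and number of faces *)

Local Open Scope card_scope.

Lemma nat_minP (A : set nat) :
  A !=set0 -> A (nat_min A) /\ forall k, A k -> (nat_min A <= k)%N.
Proof.
move=> [n An]; have ex : exists k, `[< A k >] by exists n; apply/asboolP.
have [m /asboolP Am mP] := ex_minnP ex.
apply: (@xgetPex _ 0%N [set m | A m /\ forall k, A k -> (m <= k)%N]).
by exists m; split=> // k Ak; apply/mP/asboolP.
Qed.

Lemma nat_min_eq (A : set nat) m :
  A m -> (forall k, A k -> (m <= k)%N) -> nat_min A = m.
Proof.
move=> Am Amin; have [h1 h2] := nat_minP (ex_intro _ m Am).
by apply/eqP; rewrite eqn_leq h2//= Amin.
Qed.

Lemma nat_max_le (A : set nat) B :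
  (forall k, A k -> (k <= B)%N) -> (nat_max A <= B)%N.
Proof. by rewrite /nat_max; case: xgetP => [m _ [Am _]|_ _]//; apply. Qed.

Lemma nat_max_ge (A : set nat) B c :
  (forall k, A k -> (k <= B)%N) -> A c -> (c <= nat_max A)%N.
Proof.
move=> AB Ac; have ex : exists k, `[< A k >] by exists c; apply/asboolP.
have bd k : `[< A k >] -> (k <= B)%N by move/asboolP/AB.
have [m /asboolP Am mP] := ex_maxnP ex bd.
have [] := @xgetPex _ 0%N [set m | A m /\ forall k, A k -> (k <= m)%N].
  by exists m; split=> // k Ak; apply/mP/asboolP.
by move=> _; exact.
Qed.

Lemma linfun_inj_dim (R : realType) n m (h : 'M[R]_(m, n)) (U : {vspace 'cV[R]_n}) :
  (forall x : 'cV[R]_n, h *m x = 0 -> x = 0) ->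
  \dim (linfun (mulmx h : 'cV[R]_n -> 'cV[R]_m) @: U) = \dim U.
Proof.
move=> hI; apply: limg_dim_eq; apply/eqP; rewrite -subv0; apply/subvP => x.
rewrite memv_cap memv_ker lfunE/= => /andP[_ /eqP/hI->]; exact: mem0v.
Qed.

(** The span of the lifted points meets height 0 in a subspace of codimension 1 containing all
    differences; conversely, the differences and one lifted point span it all. *)
Lemma affdim_span (R : realType) N (X : set 'cV[R]_N) (s : seq 'cV[R]_(N + 1)) :
  X !=set0 -> (forall x, X x -> lift1 x \in <<s>>%VS) ->
  (forall y, y \in s -> exists2 x, X x & y = lift1 x) ->
  (affdim X).+1 = \dim <<s>>.
Proof.
move=> [x0 Xx0] Xs sX; set U := <<s>>%VS.
(* [h] and [f] place directions at height 0; [e] reads off the height. *)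
pose h : 'M[R]_(N + 1, N) := col_mx 1%:M 0.
pose f := linfun (mulmx h : 'cV[R]_N -> 'cV[R]_(N + 1)).
pose e := linfun (mulmx (row_mx 0 1%:M) : 'cV[R]_(N + 1) -> 'cV[R]_1).
have fE x : f x = col_mx x 0 by rewrite lfunE/= mul_col_mx mul1mx mul0mx.
have eE (x : 'cV[R]_N) y : e (col_mx x y) = y by rewrite lfunE/= mul_row_col mul1mx mul0mx add0r.
have fB x y : f (x - y) = lift1 x - lift1 y.
  by rewrite fE /lift1 opp_col_mx add_col_mx subrr.
have hI (x : 'cV[R]_N) : h *m x = 0 -> x = 0.
  by rewrite mul_col_mx mul1mx mul0mx -[RHS]col_mx0 => /eq_col_mx[].
have e1 (x : 'cV[R]_N) : e (lift1 x) != 0.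
  by rewrite eE; apply/negP => /eqP/matrixP/(_ 0 0)/eqP; rewrite !mxE oner_eq0.
have dimU : (\dim (U :&: lker e)).+1 = \dim U.
  rewrite -(limg_ker_dim e U) -addn1; congr addn; apply/eqP; rewrite eqn_leq; apply/andP; split.
    rewrite lt0n dimv_eq0; apply/negP => /eqP E.
    by have := memv_img e (Xs _ Xx0); rewrite E memv0 (negPf (e1 _)).
  by apply: leq_trans (dimvS (subvf _)) _; rewrite dimvf dim_matrix.
pose W0 := (f @^-1: (U :&: lker e))%VS.
have W0P x y : X x -> X y -> x - y \in W0.
  move=> Xx Xy; rewrite -memv_preim fB memv_cap memvB ?Xs//= memv_ker.
  by rewrite linearB/= !eE subrr.
have up (W : {vspace 'cV[R]_N}) :
    (forall x y, X x -> X y -> x - y \in W) -> (\dim U <= (\dim W).+1)%N.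
  move=> WP; have : (U <= f @: W + <[lift1 x0]>)%VS.
    apply/span_subvP => y /sX[x Xx ->]; rewrite -[lift1 x](subrK (lift1 x0)) -fB.
    by apply: memv_add; [exact/memv_img/WP | exact: memv_line].
  move=> /dimvS/leq_trans; apply; apply: leq_trans (dimv_add_leqif _ _) _.
  rewrite dim_vline -[(\dim W).+1]addn1; apply: leq_add; last by case: eqP.
  by rewrite -(limg_ker_dim f W) leq_addl.
have low : (\dim W0 < \dim U)%N.
  rewrite -dimU ltnS -(linfun_inj_dim W0 hI); apply: dimvS.
  by apply/subvP => y /memv_imgP[x]; rewrite -memv_preim => xW ->.
rewrite /affdim (@nat_min_eq _ (\dim W0)).
- by apply/eqP; rewrite eqn_leq low up.
- by exists W0.
by move=> k [W <-] WP; rewrite -ltnS; apply: leq_trans low (up _ WP).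
Qed.

(** * Spans of sets of columns *)

Definition colspan (R : realType) N k (p : 'M[R]_(N, k)) (I : {set 'I_k}) :
  {vspace 'cV[R]_N} := <<[seq col j p | j in I]>>%VS.

Lemma colspanP (R : realType) N k (p : 'M[R]_(N, k)) (I : {set 'I_k}) (W : {vspace 'cV[R]_N}) :
  (forall j, j \in I -> col j p \in W) <-> (colspan p I <= W)%VS.
Proof.
split=> [h|/span_subvP h j jI]; last by apply: h; exact: (fintype.image_f (fun j => col j p) jI).
by apply/span_subvP => x /fintype.imageP[j jI ->]; exact: h.
Qed.

Lemma colspan_col (R : realType) N k (p : 'M[R]_(N, k)) (I : {set 'I_k}) j :
  j \in I -> col j p \in colspan p I.
Proof. by move=> jI; have := (colspanP p I (colspan p I)).2 (subvv _) j jI. Qed.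

Lemma colspan_sub (R : realType) N k (p : 'M[R]_(N, k)) (I J : {set 'I_k}) :
  I \subset J -> (colspan p I <= colspan p J)%VS.
Proof. by move=> /fintype.subsetP IJ; apply/colspanP => j /IJ; exact: colspan_col. Qed.

Lemma mulmx_sum_col (R : realType) N k (p : 'M[R]_(N, k)) (l : 'cV[R]_k) :
  p *m l = \sum_j l j 0 *: col j p.
Proof.
apply/colP => i; rewrite mxE summxE; apply: eq_bigr => j _; by rewrite !mxE mulrC.
Qed.

Lemma colspan_mul (R : realType) N k (p : 'M[R]_(N, k)) (I : {set 'I_k}) (l : 'cV[R]_k) :
  (forall j, l j 0 != 0 -> j \in I) -> p *m l \in colspan p I.
Proof.
move=> lI; rewrite mulmx_sum_col; apply: memv_suml => j _.
have [->|/lI jI] := eqVneq (l j 0) 0; first by rewrite scale0r mem0v.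
by rewrite memvZ// colspan_col.
Qed.

Lemma colspan_mulmx (R : realType) N M k (h : 'M[R]_(M, N)) (p : 'M[R]_(N, k)) (I : {set 'I_k}) :
  colspan (h *m p) I = (linfun (mulmx h : 'cV[R]_N -> 'cV[R]_M) @: colspan p I)%VS.
Proof.
rewrite limg_span; congr (<<_>>)%VS; rewrite -map_comp; apply: eq_map => j /=.
by rewrite lfunE/= !colE mulmxA.
Qed.

(** The height is already a linear function of the columns, namely their coordinate sum, so lifting
    is an injective linear map. *)
Lemma dim_colspan_lift1 (R : realType) N k (p : 'M[R]_(N, k)) (I : {set 'I_k}) :
  (forall j, \sum_i p i j = 1) -> \dim (colspan (lift1 p) I) = \dim (colspan p I).
Proof.
move=> p1; have -> : lift1 p = col_mx 1%:M (const_mx 1) *m p.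
  rewrite mul_col_mx mul1mx; congr col_mx; apply/matrixP => i j; rewrite mxE -[LHS](p1 j) mxE.
  by apply: eq_bigr => a _; rewrite mxE mul1r.
rewrite colspan_mulmx linfun_inj_dim// => x.
by rewrite mul_col_mx mul1mx -[RHS]col_mx0 => /eq_col_mx[].
Qed.

Lemma free_subset (R : realType) N k (p : 'M[R]_(N, k)) (I : {set 'I_k}) :
  exists J : {set 'I_k}, [/\ J \subset I, colspan p J = colspan p I & #|J| = \dim (colspan p I)].
Proof.
have [t [ts tf tE]] : exists t, [/\ subseq t (enum I), free [seq col j p | j <- t]
    & <<[seq col j p | j <- t]>>%VS = colspan p I].
  rewrite /colspan /image_mem; elim: (enum I) => [|x s [t [ts tf tE]]].
    by exists [::]; split=> //; exact: nil_free.
  have [xs|xs] := boolP (col x p \in <<[seq col j p | j <- s]>>%VS).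
    exists t; split=> //; first exact: subseq_trans ts (subseq_cons _ _).
    by rewrite tE/= span_cons; apply/esym/addv_idPr.
  exists (x :: t); split=> /=; first by rewrite eqxx.
    by rewrite free_cons tE xs.
  by rewrite !span_cons tE.
have tu : uniq t by rewrite (subseq_uniq ts)// enum_uniq.
have E : colspan p [set j in t] = colspan p I.
  rewrite -tE; apply: eq_span => x; apply/fintype.imageP/mapP => -[j jt ->]; exists j => //.
    by rewrite inE in jt.
  by rewrite inE.
exists [set j in t]; split=> //.
  by apply/fintype.subsetP => j; rewrite inE => /(mem_subseq ts); rewrite mem_enum.
by rewrite cardsE (card_uniqP tu) -tE (eqP tf) size_map.
Qed.

(** A point of a face puts weight only on the columns lying in that face. *)
Lemma affdim_face (R : realType) N k (p : 'M[R]_(N, k)) (c : 'rV[R]_N) g :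
  let F := conv p `&` [set x | (c *m x) 0 0 = g] in
  (forall j, (c *m p) 0 j <= g) -> F !=set0 ->
  (affdim F).+1 = \dim (colspan (lift1 p) [set j | (c *m p) 0 j == g]).
Proof.
move=> F cp F0; apply: affdim_span => //.
  move=> x [[l [l0 l1 xE]] cx]; have -> : lift1 x = lift1 p *m l by rewrite lift1_mul l1 xE.
  apply: colspan_mul => j lj; rewrite inE; apply/eqP.
  by apply: (conv_supporting cp l0 l1) => //; rewrite -xE.
move=> y /fintype.imageP[j]; rewrite inE => /eqP cj ->; exists (col j p).
  by split; [exact: conv_col | rewrite /= mul_colE].
by rewrite col_lift1.
Qed.

Lemma affdim_conv (R : realType) N k (p : 'M[R]_(N, k)) :
  conv p !=set0 -> (affdim (conv p)).+1 = \dim (colspan (lift1 p) [set: 'I_k]%SET).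
Proof.
have E : conv p = conv p `&` [set x | ((0 : 'rV_N) *m x) 0 0 = 0].
  by apply/seteqP; split=> [x px|x []//]; split=> //=; rewrite mul0mx mxE.
rewrite E => c0; rewrite affdim_face//; last by move=> j; rewrite mul0mx mxE.
by congr (\dim (colspan _ _)); apply/setP => j; rewrite !inE mul0mx mxE eqxx.
Qed.

(** * Counting faces *)

Lemma enumerates_card (R : realType) n v (A : set 'cV[R]_n) (V : 'M[R]_(n, v)) :
  enumerates A V -> A #= `I_v.
Proof.
move=> [VI ->]; case: v V VI => [|v] V VI.
  rewrite II0; have -> : [set x | exists j, x = col j V] = set0.
    by apply/seteqP; split=> x // -[[]].
  exact: card_eq00.
apply/card_set_bijP; exists (fun x => if pselect (exists j, x = col j V) is left e then
  val (projT1 (cid e)) else 0%N); split.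
- move=> x /= ex; case: pselect => // e; exact: ltn_ord.
- move=> x y /set_mem/= ex /set_mem/= ey; case: pselect => // e1; case: pselect => // e2.
  case: cid => i /= ->; case: cid => j /= -> ij; congr (col _ V); exact: val_inj.
move=> i /= iv; exists (col (Ordinal iv) V); first by exists (Ordinal iv).
case: pselect => [e|[]]; last by exists (Ordinal iv).
by case: cid => j /= /VI <-.
Qed.

Lemma card_covered (T : Type) (K : finType) (D : {set K}) (Phi : K -> set T) (A : set (set T)) c :
  A #= `I_c -> (forall F, A F -> exists2 J, J \in D & F = Phi J) -> (c <= #|D|)%N.
Proof.
move=> /card_esym/card_set_bijP[G [Gfun Ginj _]] AD.
have /choice[g gP] : forall i : 'I_c, exists J, J \in D /\ G i = Phi J.
  by move=> i; have [J] := AD _ (Gfun i (ltn_ord i)); exists J.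
have gI : injective g.
  move=> i j gij; apply/val_inj/Ginj; rewrite ?inE//=.
  by rewrite (gP i).2 (gP j).2 gij.
rewrite -[c]card_ord -(card_imset _ gI); apply/subset_leq_card/fintype.subsetP => J.
by move=> /imsetP[i _ ->]; have [] := gP i.
Qed.

Lemma finite_covered (T : Type) (K : finType) (D : {set K}) (Phi : K -> set T) (A : set (set T)) :
  (forall F, A F -> exists2 J, J \in D & F = Phi J) -> exists c, A #= `I_c.
Proof.
move=> AD; apply: (@sub_finite_set _ _ [set Phi J | J in [set: K]]).
  by move=> F /AD[J _ ->]; exists J.
exact/finite_image/finite_finset.
Qed.

(* A k-face is determined by k + 1 affinely independent vertices. *)
Lemma kfaces_covered (R : realType) N (Q : set 'cV[R]_N) n k :
  is_polytope Q -> vertices Q #= `I_n ->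
  exists Phi : {set 'I_n} -> set 'cV[R]_N,
    forall F, kfaces Q k F -> exists2 J, J \in [set J : {set 'I_n} | #|J| == k.+1]%SET & F = Phi J.
Proof.
move=> [Qb [f [m [C [d [A [b QE]]]]]]] Qn.
have [n' [p [Qp pV]]] : exists n' (p : 'M[R]_(N, n')), Q = conv p /\ enumerates (vertices Q) p.
  by rewrite QE in Qb *; have [n' [p [-> ?]]] := polytope_vertices Qb; exists n', p.
have nn : n = n'.
  by apply/card_eq_II; apply: card_eq_trans (card_esym Qn) (enumerates_card pV).
(* A set of vertices is sent to the intersection of Q with its affine hull. *)
subst n'; exists (fun J => conv p `&` [set x | lift1 x \in colspan (lift1 p) J]).
move=> F [[c' [g [cg FE]]] F0 Fk]; rewrite FE Qp in F0 Fk *.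
have cp j : (c' *m p) 0 j <= g by rewrite -mul_colE; apply: cg; rewrite Qp; exact: conv_col.
have := affdim_face cp F0; rewrite Fk.
set I := [set j | _]%SET; have [J [JI JE <-]] := free_subset (lift1 p) I => kI.
exists J; first by rewrite inE -kI.
rewrite JE; apply/seteqP; split=> x [px /= cx]; split=> //.
  case: px => [l [l0 l1 xE]]; have -> : lift1 x = lift1 p *m l by rewrite lift1_mul l1 xE.
  apply: colspan_mul => j lj; rewrite inE; apply/eqP.
  by apply: (conv_supporting cp l0 l1) => //; rewrite -xE.
(* The lifted functional of the face vanishes on the columns in [I], hence on their span: the affine
   hull of F meets Q in F only. *)
pose psi := linfun (mulmx (row_mx c' (- g%:M)) : 'cV[R]_(N + 1) -> 'cV[R]_1).
have : (colspan (lift1 p) I <= lker psi)%VS.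
  apply/colspanP => j; rewrite inE memv_ker lfunE/= col_lift1 mul_row_col => /eqP cj.
  apply/eqP/matrixP => a e; rewrite !ord1 mxE mul_colE cj !mxE big_ord1 !mxE eqxx mulr1n.
  by rewrite mulr1 subrr.
move=> /subvP/(_ _ cx); rewrite memv_ker lfunE/= mul_row_col => /eqP/matrixP/(_ 0 0).
rewrite mxE [X in _ + X]mxE big_ord1 !mxE eqxx mulr1n mulr1 => /eqP.
by rewrite subr_eq0 => /eqP.
Qed.

Lemma kfaces_le_bin (R : realType) N (Q : set 'cV[R]_N) n k c :
  is_polytope Q -> vertices Q #= `I_n -> kfaces Q k #= `I_c -> (c <= 'C(n, k.+1))%N.
Proof.
move=> QP Qn Qc; have [Phi PhiP] := kfaces_covered k QP Qn.
by rewrite -[X in 'C(X, _)]card_ord -card_draws; exact: card_covered Qc PhiP.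
Qed.

Lemma faces_le_bin (R : realType) n d k : (faces R n d k <= 'C(n, k.+1))%N.
Proof. by apply: nat_max_le => c [N [Q [QP _ Qn Qc]]]; exact: kfaces_le_bin Qn Qc. Qed.

Lemma le_faces (R : realType) N (Q : set 'cV[R]_N) n d k c :
  is_polytope Q -> affdim Q = d -> vertices Q #= `I_n -> kfaces Q k #= `I_c ->
  (c <= faces R n d k)%N.
Proof.
move=> QP Qd Qn Qc; apply: (nat_max_ge (B := 'C(n, k.+1))); last by exists N, Q.
by move=> c' [N' [Q' [Q'P _ Q'n Q'c]]]; exact: kfaces_le_bin Q'n Q'c.
Qed.

(** * Faces transversal to a subspace *)

(** The map [q] is a projection with kernel [W]; a coordinate of [q] nonzero at [y], scaled by minus
    its value there, takes minus a square at [y]. *)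
Lemma exists_functional (R : realType) N (W : {vspace 'cV[R]_N}) (y : 'cV[R]_N) :
  y \notin W ->
  exists2 c : 'rV[R]_N, (forall x : 'cV[R]_N, x \in W -> (c *m x) 0 0 = 0) & (c *m y) 0 0 < 0.
Proof.
move=> yW; pose q := (\1 - projv W)%VF.
have qE (x : 'cV[R]_N) : q x = x - projv W x by rewrite add_lfunE opp_lfunE id_lfunE.
have [i qi] : exists i, q y i 0 != 0.
  apply: contrapT => /forallNP h; move/negP: yW; apply.
  have /eqP : q y = 0.
    by apply/colP => i; rewrite mxE; apply/eqP; move/negP: (h i); rewrite negbK.
  by rewrite qE subr_eq0 => /eqP ->; exact: memv_proj.
pose r : 'rV[R]_N := \row_j q (delta_mx j 0) i 0.
have rE (x : 'cV[R]_N) : (r *m x) 0 0 = q x i 0.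
  rewrite [in RHS](matrix_sum_delta x) linear_sum/= summxE mxE; apply: eq_bigr => j _.
  by rewrite big_ord1 linearZ/= !mxE mulrC.
exists (- q y i 0 *: r) => [x xW|].
  by rewrite -scalemxAl mxE rE (qE x) projv_id// subrr mxE mulr0.
by rewrite -scalemxAl mxE rE mulNr oppr_lt0 -expr2 exprn_even_gt0.
Qed.

(** Serves to move from a point in both directions along a line without violating any of finitely
    many constraints: those tight at the point must be constant on the line. *)
Lemma small_step (R : realType) (T : eqType) (s : seq T) (u v : T -> R) :
  (forall b, b \in s -> 0 <= u b) -> (forall b, b \in s -> u b = 0 -> v b = 0) ->
  exists2 e, 0 < e & forall b, b \in s -> e * `|v b| <= u b.
Proof.
elim: s => [|a s IH] u0 uv; first by exists 1.
have [||e e0 ev] := IH; [by move=> b bs; apply: u0; rewrite inE bs orbT|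
  by move=> b bs; apply: uv; rewrite inE bs orbT|].
have [ua|ua] := eqVneq (u a) 0.
  exists e => // b; rewrite inE => /orP[/eqP->|/ev//].
  by rewrite uv ?mem_head// normr0 mulr0 ua.
have ua0 : 0 < u a by rewrite lt_def ua u0 ?mem_head.
have va0 : 0 < `|v a| + 1 by rewrite ltr_wpDl.
exists (Num.min e (u a / (`|v a| + 1))); first by rewrite lt_min e0 divr_gt0.
move=> b; rewrite inE => /orP[/eqP->|bs].
  have le1 : Num.min e (u a / (`|v a| + 1)) <= u a / (`|v a| + 1).
    by rewrite ge_min lexx orbT.
  apply: le_trans (ler_wpM2r (normr_ge0 _) le1) _.
  by rewrite mulrAC ler_pdivrMr// ler_pM2l// lerDl.
apply: le_trans (ev b bs); apply: ler_wpM2r => //.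
by rewrite ge_min lexx.
Qed.

(** Zeroing the other columns, instead of deleting them, keeps the index type. *)
Definition restrict_cols (R : realType) N k (p : 'M[R]_(N, k)) (I : {set 'I_k}) :=
  \matrix_(i, j) (if j \in I then p i j else 0).

Lemma cone_restrict_cols (R : realType) N k (p : 'M[R]_(N, k)) (I : {set 'I_k}) :
  cone (restrict_cols p I) `<=` cone p.
Proof.
move=> x [l l0 ->]; exists (\col_j (if j \in I then l j 0 else 0)).
  by move=> i j; rewrite mxE; case: ifP.
apply/colP => i; rewrite !mxE; apply: eq_bigr => j _; rewrite !mxE.
by case: ifP; rewrite ?mul0r ?mulr0.
Qed.

(** If every defining functional of the cone that vanishes at [w] vanished at [z] too, [small_step]
    would keep w + e z and w - e z in the cone. *)
Lemma separate_direction (R : realType) N k (p : 'M[R]_(N, k)) (w z : 'cV[R]_N) :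
  cone p w ->
  (forall e, 0 < e -> cone p (w + e *: z) -> cone p (w - e *: z) -> False) ->
  exists b : 'rV[R]_N,
    [/\ forall j, 0 <= (b *m p) 0 j, (b *m w) 0 0 = 0 & (b *m z) 0 0 != 0].
Proof.
move=> pw wz; have [B BP] := weyl_seq p; apply: contrapT => nb.
have bw b : b \in B -> 0 <= (b *m w) 0 0 by move/BP: pw; exact.
have [|e e0 eP] := small_step (s := B) (v := fun b => (b *m z) 0 0) bw.
  move=> b bB b0; apply/eqP/negPn/negP => bz; apply: nb; exists b; split=> // j.
  by rewrite -mul_colE; apply: (BP _).1 bB; exact: cone_col.
have bE b c : (b *m (w + c *: z)) 0 0 = (b *m w) 0 0 + c * (b *m z) 0 0.
  by rewrite mulmxDr -scalemxAr !mxE.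
apply: (wz e e0); apply/BP => b bB.
  rewrite bE; have := eP b bB; have := ler_norm (- (b *m z) 0 0); rewrite normrN.
  move: (bw b bB) e0; nra.
rewrite -scaleNr bE; have := eP b bB; have := ler_norm ((b *m z) 0 0).
move: (bw b bB) e0; nra.
Qed.

(** For [c] nonnegative on the columns, these index the generators of the face of the cone exposed
    by [c]. *)
Definition zeros (R : realType) N k (p : 'M[R]_(N, k)) (c : 'rV[R]_N) : {set 'I_k} :=
  [set j | (c *m p) 0 j == 0]%SET.

(* If the zero set of b does not span enough, rotate b around it (and around L)
   until one more point falls into the zero set. *)
Lemma rotate_functional (R : realType) N k (p : 'M[R]_(N, k)) (I : {set 'I_k})
    (L : {vspace 'cV[R]_N}) (w z : 'cV[R]_N) (b : 'rV[R]_N) :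
  w \in L -> z \in L ->
  (forall j, j \in I -> 0 <= (b *m p) 0 j) -> (b *m w) 0 0 = 0 -> (b *m z) 0 0 != 0 ->
  exists b' : 'rV[R]_N,
    [/\ forall j, j \in I -> 0 <= (b' *m p) 0 j, (b' *m w) 0 0 = 0, (b' *m z) 0 0 != 0 &
        (colspan p I <= colspan p (I :&: zeros p b') + L)%VS].
Proof.
move=> wL zL.
have [n] := ubnP #|I :\: zeros p b|; elim: n b => // n IH b; rewrite ltnS => In bI bw bz.
have [h|/subvPn[]] := boolP (colspan p I <= colspan p (I :&: zeros p b) + L)%VS.
  by exists b.
set W := (_ + L)%VS => y' yI y'W.
have [y yI' yW] : exists2 y, y \in I & col y p \notin W.
  apply: contrapT => h; move/negP: y'W; apply.
  suff /subvP : (colspan p I <= W)%VS by exact.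
  by apply/colspanP => j jI; apply/negPn/negP => jW; apply: h; exists j.
have [c cW cy] := exists_functional yW.
rewrite mul_colE in cy.
have cL x : x \in L -> (c *m x) 0 0 = 0.
  by move=> xL; apply: cW; apply: (subvP (addvSr _ _)).
have cZ j : j \in I -> (b *m p) 0 j = 0 -> (c *m p) 0 j = 0.
  move=> jI bj; rewrite -mul_colE; apply: cW; apply: (subvP (addvSl _ _)).
  by apply: colspan_col; rewrite !inE jI bj eqxx.
pose D := [pred j | (j \in I) && ((c *m p) 0 j < 0)].
(* Ratio test: moving from [b] along [c], the column minimizing [r] is the first to reach 0. *)
pose r j := (b *m p) 0 j / - (c *m p) 0 j.
have Dy : D y by rewrite /D/= yI' cy.
have [i /andP[iI ci] imin] := @arg_minP _ _ _ y D r Dy.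
have ci0 : 0 < - (c *m p) 0 i by rewrite oppr_gt0.
have bE t j : ((b + t *: c) *m p) 0 j = (b *m p) 0 j + t * (c *m p) 0 j.
  by rewrite mulmxDl -scalemxAl !mxE.
have bLE t x : x \in L -> ((b + t *: c) *m x) 0 0 = (b *m x) 0 0.
  by move=> xL; rewrite mulmxDl -scalemxAl mxE [X in _ + X]mxE cL// mulr0 addr0.
have ri0 : 0 <= r i by rewrite divr_ge0 ?bI// ltW.
have zi : ((b + r i *: c) *m p) 0 i = 0.
  have ri : r i * - (c *m p) 0 i = (b *m p) 0 i by rewrite divfK ?gt_eqF.
  by rewrite bE -ri mulrN addNr.
apply: (IH (b + r i *: c)).
- apply: leq_trans In; apply: proper_card; apply/fintype.properP; split.
    apply/fintype.subsetP => j; rewrite !inE => /andP[bj jI]; rewrite jI andbT.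
    by apply: contra bj => /eqP bj; rewrite bE bj (cZ j)// mulr0 addr0.
  exists i; last by rewrite !inE zi eqxx.
  rewrite !inE iI andbT; apply/eqP => bi; by move: ci; rewrite (cZ i)// ltxx.
- move=> j jI; rewrite bE; have [cj|cj] := ltP ((c *m p) 0 j) 0.
    have /imin : D j by rewrite /D/= jI cj.
    rewrite {2}/r ler_pdivlMr ?oppr_gt0// mulrN; lra.
  by rewrite addr_ge0 ?bI// mulr_ge0.
- by rewrite bLE.
by rewrite bLE.
Qed.

Lemma cone_supporting (R : realType) N k (p : 'M[R]_(N, k)) (c : 'rV[R]_N) (l : 'cV[R]_k) :
  (forall j, 0 <= (c *m p) 0 j) -> nonneg_mx l -> (c *m (p *m l)) 0 0 = 0 ->
  forall j, l j 0 != 0 -> j \in zeros p c.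
Proof.
move=> cp l0; rewrite mulmxA mxE => /eqP.
rewrite psumr_eq0 => [/allP h j lj|j _]; last exact: mulr_ge0.
by have /= := h j (mem_index_enum j); rewrite mulf_eq0 (negPf lj) orbF inE.
Qed.

Lemma cone_restrict_zeros (R : realType) N k (p : 'M[R]_(N, k)) (c : 'rV[R]_N) w :
  (forall j, 0 <= (c *m p) 0 j) -> cone p w -> (c *m w) 0 0 = 0 ->
  cone (restrict_cols p (zeros p c)) w.
Proof.
move=> cp [l l0 ->] cw; exists l => //; apply/colP => i; rewrite !mxE.
apply: eq_bigr => j _; rewrite mxE; case: ifPn => // jc.
have [->|lj] := eqVneq (l j 0) 0; first by rewrite !mulr0.
by rewrite (cone_supporting cp l0 cw lj) in jc.
Qed.

(** A face of a face is a face: for large [t], [t *: c] dominates off the zeros of [c], and [b]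
    decides on them. *)
Lemma combine_functionals (R : realType) N k (p : 'M[R]_(N, k)) (c b : 'rV[R]_N) :
  (forall j, 0 <= (c *m p) 0 j) -> (forall j, j \in zeros p c -> 0 <= (b *m p) 0 j) ->
  exists t, (forall j, 0 <= ((t *: c + b) *m p) 0 j) /\
    zeros p (t *: c + b) = zeros p c :&: zeros p b.
Proof.
move=> cp bp; pose t := \sum_j (`|(b *m p) 0 j| + 1) / (c *m p) 0 j.
have E j : ((t *: c + b) *m p) 0 j = t * (c *m p) 0 j + (b *m p) 0 j.
  by rewrite mulmxDl -scalemxAl !mxE.
have pos j : j \notin zeros p c -> 0 < t * (c *m p) 0 j + (b *m p) 0 j.
  rewrite inE => cj; have cj0 : 0 < (c *m p) 0 j by rewrite lt_def cj cp.
  have tj : (`|(b *m p) 0 j| + 1) / (c *m p) 0 j <= t.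
    rewrite /t (bigD1 j)//= lerDl; apply: sumr_ge0 => i _.
    by rewrite divr_ge0// addr_ge0.
  move: tj; rewrite ler_pdivrMr//; have := ler_norm (- (b *m p) 0 j); rewrite normrN; lra.
have zer j : j \in zeros p c -> t * (c *m p) 0 j = 0.
  by rewrite inE => /eqP ->; rewrite mulr0.
exists t; split=> [j|].
  rewrite E; have [jc|/pos/ltW//] := boolP (j \in zeros p c).
  by rewrite zer// add0r bp.
apply/setP => j; rewrite finset.in_setI [in LHS]inE E.
have [jc|/pos/gt_eqF//] := boolP (j \in zeros p c).
by rewrite zer// add0r inE.
Qed.

(* The face through w that is complementary to L is found by minimality: as long
   as L contains another direction z of the face, some supporting functional of
   the face vanishes at w but not at z. *)
Lemma transversal_face (R : realType) N k (p : 'M[R]_(N, k))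
    (L : {vspace 'cV[R]_N}) (w : 'cV[R]_N) :
  cone p w -> w \in L ->
  (forall z, z \in L -> cone p (w + z) -> cone p (w - z) -> z \in <[w]>%VS) ->
  exists c : 'rV[R]_N,
    [/\ forall j, 0 <= (c *m p) 0 j, (c *m w) 0 0 = 0,
        (colspan p (zeros p c) :&: L <= <[w]>)%VS &
        (colspan p [set: 'I_k]%SET <= colspan p (zeros p c) + L)%VS].
Proof.
move=> pw wL wX.
have start : exists c : 'rV[R]_N, [/\ forall j, 0 <= (c *m p) 0 j, (c *m w) 0 0 = 0 &
        (colspan p [set: 'I_k]%SET <= colspan p (zeros p c) + L)%VS].
  exists 0; split=> [j||]; rewrite ?mul0mx ?mxE//.
  have -> : zeros p 0 = [set: 'I_k]%SET by apply/setP => j; rewrite !inE mul0mx mxE eqxx.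
  exact: addvSl.
case: start => c; have [n] := ubnP #|zeros p c|; elim: n c => // n IH c.
rewrite ltnS => cn [cp cw cE].
have [h|/subvPn[z]] := boolP (colspan p (zeros p c) :&: L <= <[w]>)%VS; first by exists c.
rewrite memv_cap => /andP[zc zL] zw; set I := zeros p c in cn cE zc.
have [||b [bp bw bz]] := @separate_direction _ _ _ (restrict_cols p I) w z.
- exact: cone_restrict_zeros.
- move=> e e0 /cone_restrict_cols w1 /cone_restrict_cols w2; move/negP: zw; apply.
  have := wX (e *: z) (memvZ e zL) w1 w2 => /(memvZ e^-1).
  by rewrite scalerA mulVf ?gt_eqF// scale1r.
have bI j : j \in I -> 0 <= (b *m p) 0 j.
  move=> jI; have := bp j; rewrite !mxE; congr (0 <= _); apply: eq_bigr => i _.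
  by rewrite mxE jI.
(* The face cut out by [b] alone may be too small; rotation preserves the span modulo [L]. The face
   still shrinks strictly, since [b'] is nonzero at [z], which lies in its span. *)
have [b' [b'I b'w b'z b'E]] := rotate_functional wL zL bI bw bz.
have [t [tp tz]] := combine_functionals cp b'I.
apply: (IH (t *: c + b')).
  apply: leq_trans cn; apply: proper_card; rewrite tz; apply/fintype.properP; split.
    exact: finset.subsetIl.
  apply: contrapT => h; move/negP: b'z; apply.
  have : (colspan p I <= lker (linfun (mulmx b' : 'cV[R]_N -> 'cV[R]_1)))%VS.
    apply/colspanP => j jI; rewrite memv_ker lfunE/=; apply/eqP/matrixP => i i'.
    rewrite !ord1 mul_colE [RHS]mxE; apply/eqP/negPn/negP => bj; apply: h.
    by exists j => //; rewrite !inE negb_and bj orbT.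
  by move=> /subvP/(_ _ zc); rewrite memv_ker lfunE/= => /eqP ->; rewrite mxE.
split=> //.
  by rewrite mulmxDl -scalemxAl mxE [X in X + _]mxE cw mulr0 add0r.
rewrite tz; apply: subv_trans cE _; rewrite subv_add b'E; exact: addvSr.
Qed.

(** * Slack matrices *)

Lemma leq_bin_half n k : ('C(n, k) <= 'C(n, n./2))%N.
Proof.
have mono j : (j.*2 < n)%N -> ('C(n, j) <= 'C(n, j.+1))%N.
  move=> jn; have := mul_bin_left n j.
  have h1 : (j.+1 <= n - j)%N by rewrite leq_subRL; lia.
  move=> E; have : (j.+1 * 'C(n, j) <= j.+1 * 'C(n, j.+1))%N by rewrite E leq_mul2r h1 orbT.
  by rewrite leq_pmul2l.
have low j i : (j + i = n./2 -> 'C(n, j) <= 'C(n, n./2))%N.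
  elim: i j => [|i IH] j; first by rewrite addn0 => ->.
  move=> ji; apply: leq_trans (IH j.+1 _); last by lia.
  by apply: mono; lia.
have [kn|kn] := leqP k n; last by rewrite bin_small.
have [kh|kh] := leqP k n./2; first by apply: (low k (n./2 - k)%N); lia.
rewrite -bin_sub//; apply: (low _ (n./2 - (n - k))%N); lia.
Qed.

Lemma leq_bin_expn2 n k : ('C(n, k) <= 2 ^ n)%N.
Proof.
rewrite -[n in 'C(n, _)]card_ord -card_draws; apply: leq_trans (max_card _) _.
rewrite -cardsT -powersetT card_powerset cardsT card_ord; exact: leqnn.
Qed.

Lemma phi_le_bin (R : realType) r rp :
  (phi R r rp <= \max_(r <= ru < rp.+1) 'C(rp, ru - r + 1))%N.
Proof.
apply: (big_ind2 leq) => // [a b c d ab cd|ru _]; last by rewrite addn1 faces_le_bin.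
by rewrite geq_max !leq_max ab cd orbT.
Qed.

Lemma bigmax_bin_le r rp :
  (\max_(r <= ru < rp.+1) 'C(rp, ru - r + 1) <= 'C(rp, rp./2))%N.
Proof. by elim/big_ind : _ => // [a b|ru _]; rewrite ?geq_max ?leq_bin_half// => -> ->. Qed.

Lemma phi_le_expn2 (R : realType) r rp : (phi R r rp <= 2 ^ rp)%N.
Proof.
apply: leq_trans (phi_le_bin R r rp) _; apply: leq_trans (bigmax_bin_le r rp) _.
exact: leq_bin_expn2.
Qed.

(** * Minimal nonnegative factorizations *)

Lemma nonneg_rank_le (R : realType) m n k (M : 'M[R]_(m, n)) (U : 'M[R]_(m, k)) (V : 'M[R]_(k, n)) :
  nonneg_mx U -> nonneg_mx V -> M = U *m V -> (nonneg_rank M <= k)%N.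
Proof.
move=> U0 V0 E; have ne : [set k | exists (U : 'M[R]_(m, k)) (V : 'M[R]_(k, n)),
    [/\ nonneg_mx U, nonneg_mx V & M = U *m V]] !=set0 by exists k, U, V.
by apply: (nat_minP ne).2; exists U, V.
Qed.

Lemma minimal_factor_irredundant (R : realType) m n k (U : 'M[R]_(m, k)) (V : 'M[R]_(k, n)) :
  nonneg_mx U -> nonneg_mx V -> nonneg_rank (U *m V) = k -> irredundant U.
Proof.
case: k U V => [U V _ _ _ []//|k] U V U0 V0 UV i l l0 li E.
have [V' V'0 UV'] := drop_col l0 li E V0.
suff : (nonneg_rank (U *m V) <= k)%N by rewrite UV ltnn.
by apply: nonneg_rank_le UV' => // a b; rewrite mxE.
Qed.

(** Irredundance rules out zero columns, so those of U can be scaled to sum 1 and the rows of V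
    inversely. The length is unchanged, so minimality makes the scaled factor irredundant again. *)
Lemma nonneg_rank_factor (R : realType) m n (M : 'M[R]_(m, n)) :
  nonneg_mx M ->
  exists (U : 'M[R]_(m, nonneg_rank M)) (V : 'M[R]_(nonneg_rank M, n)),
    [/\ nonneg_mx U, nonneg_mx V, M = U *m V, irredundant U & forall j, \sum_i U i j = 1].
Proof.
move=> M0; have [|[U [V [U0 V0 UV]]] _] := @nat_minP [set k | exists (U : 'M[R]_(m, k))
    (V : 'M[R]_(k, n)), [/\ nonneg_mx U, nonneg_mx V & M = U *m V]].
  exists n, M, 1%:M; split; rewrite ?mulmx1// => i j; rewrite mxE; exact: ler0n.
rewrite -/(nonneg_rank M) in U V U0 V0 UV.
have UI : irredundant U by apply: minimal_factor_irredundant V0 _; rewrite -?UV.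
pose s j := \sum_i U i j.
have s0 j : 0 < s j.
  rewrite lt_def sumr_ge0 ?andbT//; apply/eqP => sj.
  apply: (UI j 0); first exact: nonneg_mx0.
    by rewrite mxE.
  rewrite mulmx0; apply/colP => i; rewrite !mxE; move/eqP: sj; rewrite psumr_eq0//.
  by move=> /allP/(_ i (mem_index_enum i))/eqP.
pose U' := \matrix_(i, j) (U i j / s j); pose V' := \matrix_(j, b) (s j * V j b).
have UV' : M = U' *m V'.
  apply: (etrans UV); apply/matrixP => a b; rewrite !mxE; apply: eq_bigr => j _; rewrite !mxE.
  by rewrite mulrA divfK// gt_eqF.
have U'0 : nonneg_mx U' by move=> i j; rewrite mxE divr_ge0// ltW.
have V'0 : nonneg_mx V' by move=> i j; rewrite mxE mulr_ge0// ltW.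
exists U', V'; split=> //.
  by apply: minimal_factor_irredundant V'0 _; rewrite -?UV'.
move=> j; under eq_bigr do rewrite mxE; by rewrite -mulr_suml -/(s j) divff// gt_eqF.
Qed.

(** * The homogenized slack matrix *)

Section Slack.
Context (R : realType) (n f m v : nat).
Context (C : 'M[R]_(f, n)) (d : 'cV[R]_f) (A : 'M[R]_(m, n)) (b : 'cV[R]_m) (V : 'M[R]_(n, v)).
Let P := polyhedron C d A b.
Let S := slack_matrix C d V.
Context (Pb : is_bounded P) (PV : enumerates (vertices P) V) (S0 : S != 0).

Let D : 'M[R]_(f, n + 1) := row_mx C (- d).
Let E : 'M[R]_(m, n + 1) := row_mx A (- b).

Lemma slackE : S = D *m lift1 V.
Proof.
apply/matrixP => i j; rewrite mul_row_col !mxE big_ord1 !mxE mulr1; congr (_ - _).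
by apply: eq_bigr => k _; rewrite mxE.
Qed.

(** [polytope_vertices] gives the result for some enumeration of the vertices; the hulls of two
    enumerations contain each other. *)
Lemma polyhedron_conv_vertices : P = conv V.
Proof.
have [k [p [PE pV]]] := polytope_vertices Pb.
have sub k1 k2 (p1 : 'M[R]_(n, k1)) (p2 : 'M[R]_(n, k2)) :
    enumerates (vertices P) p1 -> enumerates (vertices P) p2 -> conv p1 `<=` conv p2.
  move=> [_ p1E] [_ p2E]; have [f' [m' [C' [d' [A' [b' p2P]]]]]] := conv_polyhedron p2.
  rewrite p2P; apply: polyhedron_conv => j; rewrite -p2P.
  have : [set x | exists j, x = col j p1] (col j p1) by exists j.
  by rewrite -p1E p2E => -[i ->]; exact: conv_col.
rewrite -PE in pV; rewrite {1}/P PE; apply/seteqP; split; exact: sub.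
Qed.

Lemma vertex_in j : P (col j V).
Proof. by rewrite polyhedron_conv_vertices; exact: conv_col. Qed.

Lemma slack_ge0 : nonneg_mx S.
Proof.
move=> i j; rewrite mxE subr_ge0; by have [] := vertex_in j.
Qed.

Let D_col (x : 'cV[R]_n) t i : (D *m col_mx x (const_mx t)) i 0 = (C *m x) i 0 - t * d i 0.
Proof.
rewrite mul_row_col mulNmx mxE [X in _ + X]mxE [X in _ - X]mxE big_ord1.
by rewrite [const_mx _ _ _]mxE [X in _ - X]mulrC.
Qed.

Let E_col (x : 'cV[R]_n) t : E *m col_mx x (const_mx t) = A *m x - t *: b.
Proof.
rewrite mul_row_col mulNmx; congr (_ - _).
by apply/colP => i; rewrite !mxE big_ord1 mxE mulrC.
Qed.

Let vertex_hom j : E *m col j (lift1 V) = 0.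
Proof. by rewrite col_lift1 E_col scale1r (vertex_in j).2 subrr. Qed.

Let some_vertex : exists j, col j S != 0.
Proof.
apply: contrapT => /forallNP h; move/negP: S0; apply; apply/eqP/matrixP => i j.
move/negP: (h j); rewrite negbK => /eqP/colP/(_ i).
by rewrite [LHS]mxE => ->; rewrite !mxE.
Qed.

(** At height 0, x is a recession direction of P, hence 0. At height t < 0, x - t q is one for every
    q in P, so P is a single point where all slacks vanish, contrary to [S0]. *)
Lemma slack_hom_cases (x : 'cV[R]_n) t :
  E *m col_mx x (const_mx t) = 0 -> nonneg_mx (D *m col_mx x (const_mx t)) ->
  col_mx x (const_mx t) = 0 :> 'cV[R]_(n + 1) \/ 0 < t.
Proof.
rewrite E_col => /eqP; rewrite subr_eq0 => /eqP Ax Dx.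
have Cx i : t * d i 0 <= (C *m x) i 0 by have := Dx i 0; rewrite D_col subr_ge0.
have [j Sj] := some_vertex; have [Cv Av] := vertex_in j.
have [t0|t0|t0] := ltgtP t 0; last 1 first.
- left; rewrite t0 in Ax Cx *; have -> : x = 0.
    apply: (bounded_recession Pb (vertex_in j)); last by rewrite Ax scale0r.
    by move=> i; have := Cx i; rewrite mul0r.
  by rewrite -[RHS]col_mx0; congr col_mx; apply/matrixP => i i'; rewrite !mxE.
- exfalso; have xE q : P q -> x = t *: q.
    move=> [Cq Aq]; apply/eqP; rewrite -subr_eq0; apply/eqP.
    apply: (bounded_recession Pb (vertex_in j)); last by rewrite mulmxBr Ax -scalemxAr Aq subrr.
    move=> i; rewrite mulmxBr -scalemxAr mxE [X in _ + X]mxE [X in _ - X]mxE subr_ge0.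
    by apply: le_trans (Cx i); rewrite ler_nM2l.
  move/negP: Sj; apply; apply/eqP/colP => i; rewrite 2![LHS]mxE [RHS]mxE.
  apply/eqP; rewrite subr_eq0 eq_le.
  rewrite Cv andbT; have := Cx i; rewrite (xE _ (vertex_in j)) -scalemxAr [X in _ <= X]mxE.
  by rewrite ler_nM2l.
by right.
Qed.

(** Both [y] and its opposite fall under [slack_hom_cases], and their heights cannot both be
    positive. *)
Lemma slack_hom_inj (y : 'cV[R]_(n + 1)) : E *m y = 0 -> D *m y = 0 -> y = 0.
Proof.
have [x [t ->]] : exists (x : 'cV[R]_n) t, y = col_mx x (const_mx t).
  exists (usubmx y), (dsubmx y 0 0); rewrite -[LHS]vsubmxK; congr col_mx.
  by apply/matrixP => i j; rewrite !ord1 [RHS]mxE.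
have hN : - col_mx x (const_mx t) = col_mx (- x) (const_mx (- t)) :> 'cV[R]_(n + 1).
  by rewrite opp_col_mx; congr col_mx; apply/matrixP => i j; rewrite !mxE.
move=> Ey Dy; set y' := col_mx _ _ in Ey Dy hN *.
have D0 : nonneg_mx (D *m y') by rewrite Dy; exact: nonneg_mx0.
have EN : E *m col_mx (- x) (const_mx (- t)) = 0 by rewrite -hN mulmxN Ey oppr0.
have DN : nonneg_mx (D *m col_mx (- x) (const_mx (- t))).
  by rewrite -hN mulmxN Dy oppr0; exact: nonneg_mx0.
have [//|t0] := slack_hom_cases Ey D0.
have [/eqP|] := slack_hom_cases EN DN; first by rewrite -hN oppr_eq0 => /eqP.
by rewrite oppr_gt0 ltNge ltW.
Qed.

Let Y := colspan (lift1 V) [set: 'I_v]%SET.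
Let L := colspan S [set: 'I_v]%SET.

Let Y_hom y : y \in Y -> E *m y = 0.
Proof.
have : (Y <= lker (linfun (mulmx E : 'cV[R]_(n + 1) -> 'cV[R]_m)))%VS.
  by apply/colspanP => j _; rewrite memv_ker lfunE/= vertex_hom.
by move=> /subvP h /h; rewrite memv_ker lfunE/= => /eqP.
Qed.

Let LE : L = (linfun (mulmx D : 'cV[R]_(n + 1) -> 'cV[R]_f) @: Y)%VS.
Proof. by rewrite -colspan_mulmx -slackE. Qed.

Let L_lift z : z \in L -> exists2 y, y \in Y & z = D *m y.
Proof. by rewrite LE => /memv_imgP[y yY ->]; exists y => //; rewrite lfunE. Qed.

(** [D] maps the span of the lifted vertices onto the column space of S, injectively by
    [slack_hom_inj]. *)
Lemma slack_dim : \dim L = (affdim P).+1.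
Proof.
have [j _] := some_vertex; rewrite polyhedron_conv_vertices affdim_conv; last first.
  by exists (col j V); exact: conv_col.
rewrite LE; apply: limg_dim_eq; apply/eqP; rewrite -subv0; apply/subvP => y.
rewrite memv_cap memv_ker lfunE/= => /andP[/Y_hom Ey /eqP Dy].
by rewrite (slack_hom_inj Ey Dy) mem0v.
Qed.

Lemma slack_col_neq0 j : col j S != 0.
Proof.
apply/eqP => Sj; have /colP/(_ (rshift n 0)) : col j (lift1 V) = 0.
  by apply: slack_hom_inj; rewrite ?vertex_hom// -Sj slackE !colE mulmxA.
by rewrite col_lift1 col_mxEd !mxE => /eqP; rewrite oner_eq0.
Qed.

(** Vertices of P give extreme rays of the nonnegative part of [L]: both perturbed columns pull back
    to positive multiples of lifted points of P, unless one of them is 0. *)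
Lemma slack_extreme j z : z \in L ->
  nonneg_mx (col j S + z) -> nonneg_mx (col j S - z) -> z \in <[col j S]>%VS.
Proof.
move=> /L_lift[y yY ->]; have Ey := Y_hom yY.
have Sj : col j S = D *m lift1 (col j V) by rewrite -col_lift1 slackE !colE mulmxA.
move: (vertex_hom j); rewrite col_lift1 => Ej.
have [x [t yE]] : exists (x : 'cV[R]_n) t, y = col_mx x (const_mx t).
  exists (usubmx y), (dsubmx y 0 0); rewrite -[LHS]vsubmxK; congr col_mx.
  by apply/matrixP => a c; rewrite !ord1 [RHS]mxE.
rewrite Sj -mulmxDr -mulmxBr.
have addE : lift1 (col j V) + y = col_mx (col j V + x) (const_mx (1 + t)).
  by rewrite yE add_col_mx; congr col_mx; apply/matrixP => a c; rewrite !mxE.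
have subE : lift1 (col j V) - y = col_mx (col j V - x) (const_mx (1 - t)).
  by rewrite yE opp_col_mx add_col_mx; congr col_mx; apply/matrixP => a c; rewrite !mxE.
have EA : E *m (lift1 (col j V) + y) = 0 by rewrite mulmxDr Ej Ey addr0.
have EB : E *m (lift1 (col j V) - y) = 0 by rewrite mulmxBr Ej Ey subr0.
rewrite addE subE in EA EB *; move=> DA DB.
have [/eqP|tA] := slack_hom_cases EA DA.
  by rewrite -addE addrC addr_eq0 => /eqP ->; rewrite mulmxN memvN memv_line.
have [/eqP|tB] := slack_hom_cases EB DB.
  by rewrite -subE subr_eq0 => /eqP ->; exact: memv_line.
have inP u s : 0 < s -> E *m col_mx u (const_mx s) = 0 ->
    nonneg_mx (D *m col_mx u (const_mx s)) -> P (s^-1 *: u).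
  rewrite E_col => s0 /eqP; rewrite subr_eq0 => /eqP Au Du; split.
    by move=> i; rewrite -scalemxAr mxE mulrC ler_pdivlMr// mulrC -subr_ge0 -D_col.
  by rewrite -scalemxAr Au scalerA mulVf ?scale1r// gt_eqF.
have PA := inP _ _ tA EA DA; have PB := inP _ _ tB EB DB.
have : vertices P (col j V) by rewrite PV.2; exists j.
move=> [c [g [cg vE]]].
have cv : (c *m col j V) 0 0 = g.
  by have : [set col j V] (col j V) by []; rewrite vE => -[].
(* The vertex is the combination of these two points of P with weights (1 + t)/2 and (1 - t)/2, so
   [c] attains its maximum at both. *)
have : [set col j V] ((1 + t)^-1 *: (col j V + x)).
  rewrite vE; split=> //=; apply/eqP; rewrite eq_le cg//=.
  have cE s e : (c *m (s *: (col j V + e *: x))) 0 0 = s * (g + e * (c *m x) 0 0).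
    by rewrite -cv -scalemxAr mulmxDr -scalemxAr !mxE.
  have := cg _ PB; rewrite -scaleN1r cE -[X in _ *: (_ + X)]scale1r cE.
  by rewrite mulrC ler_pdivrMr// [_ * (g + _)]mulrC ler_pdivlMr//; lra.
move=> /= xE; have {}xE : x = t *: col j V.
  have : (1 + t) *: ((1 + t)^-1 *: (col j V + x)) = (1 + t) *: col j V by rewrite xE.
  rewrite scalerA divff ?gt_eqF// scale1r scalerDl scale1r => /addrI; exact.
apply/vlineP; exists t; rewrite scalemxAr yE; congr (_ *m _).
by rewrite xE /lift1 scale_col_mx; congr col_mx; apply/matrixP => a c'; rewrite !mxE mulr1.
Qed.

(** Proportionality lifts to the vertices because [D] is injective there, and height 1 forces the
    factor to be 1. *)
Lemma slack_col_proportional i j : col j S \in <[col i S]>%VS -> i = j.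
Proof.
move=> /vlineP[a Sij].
have : col j (lift1 V) - a *: col i (lift1 V) = 0.
  apply: slack_hom_inj; rewrite mulmxBr -scalemxAr ?vertex_hom ?scaler0 ?subr0//.
  by apply/eqP; rewrite subr_eq0; apply/eqP; move: Sij; rewrite slackE !colE !mulmxA.
move=> /eqP; rewrite subr_eq0 => /eqP; rewrite !col_lift1 /lift1 scale_col_mx.
move=> /eq_col_mx[vE /matrixP/(_ 0 0)]; rewrite !mxE mulr1 => a1.
by apply/esym; apply: PV.1; rewrite vE -a1 scale1r.
Qed.

End Slack.

Lemma cone_conv (R : realType) N k (p : 'M[R]_(N, k)) w :
  cone p w -> w != 0 -> exists2 s, 0 < s & conv p (s *: w).
Proof.
move=> [l l0 wE] w0; have s0 : 0 < \sum_j l j 0.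
  rewrite lt_def sumr_ge0 ?andbT//; apply: contra w0; rewrite psumr_eq0// => /allP l00.
  rewrite wE; have -> : l = 0; last by rewrite mulmx0.
  by apply/colP => j; rewrite mxE; apply/eqP/l00/mem_index_enum.
exists (\sum_j l j 0)^-1; first by rewrite invr_gt0.
exists ((\sum_j l j 0)^-1 *: l); split.
- by apply: nonneg_mxZ => //; rewrite invr_ge0 ltW.
- by under eq_bigr do rewrite mxE; rewrite -mulr_sumr mulVf// gt_eqF.
by rewrite -scalemxAr wE.
Qed.

Lemma leq_card_family (T : Type) (A : set (set T)) v c (F : 'I_v -> set T) :
  injective F -> (forall i, A (F i)) -> A #= `I_c -> (v <= c)%N.
Proof.
move=> FI FA /card_esym/card_set_bijP[G [_ _ Gsurj]].
have /choice[h hP] : forall i, exists j : 'I_c, G j = F i.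
  by move=> i; have [j jc jE] := Gsurj _ (FA i); exists (Ordinal jc).
rewrite -[v]card_ord -[c]card_ord; apply: (@leq_card _ _ h) => i j hij.
by apply: FI; rewrite -!hP hij.
Qed.

(** * From vertices of the polytope to faces of the factor polytope *)

Section VertexCount.
Context (R : realType) (n f m v : nat).
Context (C : 'M[R]_(f, n)) (d : 'cV[R]_f) (A : 'M[R]_(m, n)) (b : 'cV[R]_m) (V : 'M[R]_(n, v)).
Let P := polyhedron C d A b.
Let S := slack_matrix C d V.
Context (Pb : is_bounded P) (PV : enumerates (vertices P) V) (S0 : S != 0).

(* Up to scaling, P is the section by the column space L of S of the polytope T
   spanned by the columns of a minimal nonnegative left factor of S.  Each vertex
   of P lies on a face of T of dimension dim T - dim P that meets L only there. *)
Lemma leq_vertices_phi : (v <= phi R (affdim P).+1 (nonneg_rank S))%N.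
Proof.
have Sge0 : nonneg_mx S := slack_ge0 Pb PV.
have [v0|v0] := posnP v; first by apply: leq_trans (leq0n _); rewrite v0.
have [U [W [U0 W0 SE UI U1]]] := nonneg_rank_factor Sge0.
move: U W U0 W0 SE UI U1; move: (nonneg_rank S) => k U W U0 W0 SE UI U1.
set L := colspan S [set: 'I_v]%SET; have dimL : \dim L = (affdim P).+1 := slack_dim Pb PV S0.
rewrite -dimL; pose ru := \dim (colspan U [set: 'I_k]%SET).
have UL : (L <= colspan U [set: 'I_k]%SET)%VS.
  by apply/colspanP => j _; rewrite SE colE -mulmxA -colE; apply: colspan_mul => i _; rewrite inE.
have rru : (\dim L <= ru)%N by apply: dimvS.
have ruk : (ru <= k)%N.
  by apply: leq_trans (dim_span _) _; rewrite size_map -cardE cardsT card_ord.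
have Uw j : cone U (col j S).
  by exists (col j W); [exact: nonneg_col | rewrite SE !colE mulmxA].
have cone0 x : cone U x -> nonneg_mx x by move=> [l l0 ->]; exact: nonneg_mxM.
have wL j : col j S \in L by apply: colspan_col; rewrite inE.
have w0 j : col j S != 0 by exact: (slack_col_neq0 Pb PV S0).
have /choice[c cP] : forall j, exists c : 'rV[R]_f,
    [/\ forall i, 0 <= (c *m U) 0 i, (c *m col j S) 0 0 = 0,
        (colspan U (zeros U c) :&: L <= <[col j S]>)%VS &
        (colspan U [set: 'I_k]%SET <= colspan U (zeros U c) + L)%VS].
  move=> j; apply: transversal_face => // z zL /cone0 w1 /cone0 w2.
  exact: (slack_extreme Pb PV S0).
pose F j := conv U `&` [set x | (- c j *m x) 0 0 = 0].
have Fw j : exists2 s, 0 < s & F j (s *: col j S).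
  have [s s0 ws] := cone_conv (Uw j) (w0 j); exists s => //; split=> //=.
  by have [_ cw _ _] := cP j; rewrite -scalemxAr mulNmx [LHS]mxE [X in _ * X]mxE cw oppr0 mulr0.
have cN j i : (- c j *m U) 0 i <= 0.
  by have [cU _ _ _] := cP j; rewrite mulNmx mxE oppr_le0.
have FI : injective F.
  (* If the faces of i and j coincide, [c i] vanishes at [col j S], which therefore lies in the span
     of the face and in [L], that is on the line of [col i S]. *)
  move=> i j Fij; have [s s0] := Fw j; rewrite -Fij => -[_ /=].
  rewrite -scalemxAr mulNmx [LHS]mxE [X in _ * X]mxE mulrN => /eqP.
  rewrite oppr_eq0 mulf_eq0 gt_eqF//= => /eqP cij.
  apply: (slack_col_proportional Pb PV S0); have [cU _ cL _] := cP i.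
  apply: (subvP cL); rewrite memv_cap wL andbT.
  have [l l0 wE] := Uw j; rewrite wE; apply: colspan_mul.
  by apply: cone_supporting; rewrite // -wE.
have Tk : vertices (conv U) #= `I_k.
  apply: enumerates_card (irredundant_vertices _) => i l l0 li.
  by rewrite col_lift1 lift1_mul => /eq_col_mx[/(UI i l l0 li)].
have Td : affdim (conv U) = ru.-1.
  have [s _ [Ts _]] := Fw (Ordinal v0).
  by rewrite /ru -dim_colspan_lift1// -affdim_conv//; exists (s *: col (Ordinal v0) S).
have FK j : kfaces (conv U) (ru - \dim L) (F j).
  have [s _ Fs] := Fw j; split; last 1 first.
  - have := @affdim_face _ _ _ U (- c j) 0 (cN j) (ex_intro _ _ Fs).
    have -> : [set i | (- c j *m U) 0 i == 0]%SET = zeros U (c j).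
      by apply/setP => i; rewrite !inE mulNmx mxE oppr_eq0.
    rewrite dim_colspan_lift1// -/(F j) => dF; have [cU cw cL cT] := cP j.
    have := dimv_sum_cap (colspan U (zeros U (c j))) L.
    have -> : (colspan U (zeros U (c j)) + L = colspan U [set: 'I_k]%SET)%VS.
      apply/eqP; rewrite eqEsubv cT andbT subv_add UL andbT; apply: colspan_sub.
      exact: finset.subsetT.
    have -> : (colspan U (zeros U (c j)) :&: L = <[col j S]>)%VS.
      apply/eqP; rewrite eqEsubv cL/=.
      rewrite -memvE memv_cap wL andbT; have [l l0 wE] := Uw j; rewrite wE.
      by apply: colspan_mul; apply: cone_supporting; rewrite // -wE.
    (* The span Z of the face has dim Z + dim L = ru + 1, the 1 being the line of [col j S], and the
       face has dimension dim Z - 1. *)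
    rewrite dim_vline w0 -/ru -dF; lia.
  - exists (- c j), 0; split=> // x [l [l0 _ ->]]; rewrite mulmxA mxE.
    by apply: sumr_le0 => i _; rewrite mulr_le0_ge0.
  by exists (s *: col j S).
have [Phi PhiP] := kfaces_covered (ru - \dim L) (conv_is_polytope U) Tk.
have [c' Tc] := finite_covered PhiP.
apply: leq_trans (leq_card_family FI FK Tc) _.
apply: leq_trans (le_faces (conv_is_polytope U) Td Tk Tc) _.
by apply: (@leq_bigmax_seq _ _ _ (fun ru => faces R k ru.-1 (ru - \dim L)));
  rewrite ?mem_index_iota ?rru.
Qed.

End VertexCount.

(** * Extended formulations *)

Section Extension.
Context (R : realType) (n f m v : nat).
Context (C : 'M[R]_(f, n)) (d : 'cV[R]_f) (A : 'M[R]_(m, n)) (b : 'cV[R]_m) (V : 'M[R]_(n, v)).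
Let P := polyhedron C d A b.
Let S := slack_matrix C d V.
Context (Pb : is_bounded P) (PV : enumerates (vertices P) V).

(* By Farkas' lemma each facet inequality of P is a nonnegative combination of
   the constraints of the extension, so S factors through their slacks. *)
Lemma nonneg_rank_le_ext_size s :
  (0 < n)%N -> ext_sizes P s -> (nonneg_rank S <= 2 * s)%N.
Proof.
move=> n0 [p [q [e [G [h [E [g [PE ->]]]]]]]].
(* The inner size is the row count of the homogenized extension; [n0] absorbs the final 1. *)
suff : (nonneg_rank S <= q + (e + (e + 1)))%N by lia.
have [H HP] := homogenize G h E g.
have /choice[z zP] : forall j : 'I_v, exists z, polyhedron G h E g z /\ usubmx z = col j V.
  move=> j; have := vertex_in Pb PV j; rewrite -/P PE => -[y Qy].
  by exists (col_mx (col j V) y); rewrite col_mxKu.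
(* The i-th slack of P as a homogeneous functional on the extended space, ignoring the coordinates
   y. *)
pose c i : 'rV[R]_(n + p + 1) := row_mx (row_mx (row i C) 0) (- (d i 0)%:M).
have cE i u : (c i *m lift1 u) 0 0 = (C *m usubmx u) i 0 - d i 0.
  rewrite /c mul_row_col mxE -[in LHS](vsubmxK u) mul_row_col mul0mx addr0 row_mulE.
  by rewrite mulNmx [X in _ + X]mxE mul_scalar_mx !mxE mulr1.
have Hz j : nonneg_mx (H *m lift1 (z j)).
  by apply/(polyhedron_hom HP); have [] := zP j.
have key i (y : 'cV[R]_(n + p + 1)) : (0 < v)%N -> nonneg_mx (H *m y) -> 0 <= (c i *m y) 0 0.
  move=> v0 Hy.
  have pos (u : 'cV[R]_(n + p)) t : 0 < t -> nonneg_mx (H *m col_mx u (const_mx t)) ->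
      0 <= (c i *m col_mx u (const_mx t)) 0 0.
    move=> t0 Hu; have uE : col_mx u (const_mx t) = t *: lift1 (t^-1 *: u).
      rewrite /lift1 scale_col_mx scalerA divff ?gt_eqF// scale1r; congr col_mx.
      by apply/matrixP => a a'; rewrite !mxE mulr1.
    have : P (usubmx (t^-1 *: u)).
      rewrite PE; exists (dsubmx (t^-1 *: u)); rewrite vsubmxK.
      apply/(polyhedron_hom HP) => a a'; have := Hu a a'.
      by rewrite uE -scalemxAr mxE pmulr_rge0.
    move=> [/(_ i) dC _]; rewrite uE -scalemxAr mxE cE mulr_ge0 ?subr_ge0//; exact: ltW.
  have [u [t yE]] : exists (u : 'cV[R]_(n + p)) t, y = col_mx u (const_mx t).
    exists (usubmx y), (dsubmx y 0 0); rewrite -[LHS]vsubmxK; congr col_mx.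
    by apply/matrixP => a a'; rewrite !ord1 [RHS]mxE.
  have t0 : 0 <= t by move: Hy; rewrite yE => /HP[].
  have z0 : 0 <= (c i *m lift1 (z (Ordinal v0))) 0 0 by exact: pos ltr01 (Hz _).
  rewrite leNgt; apply/negP => cy.
  (* Height 0 is reduced to positive height by adding a lifted point; this [a] makes the functional
     equal to -1 there. *)
  set cz := (c i *m _) 0 0 in z0; pose a := (cz + 1) / - (c i *m y) 0 0.
  have a0 : 0 <= a by rewrite divr_ge0 ?addr_ge0// oppr_ge0 ltW.
  have uE : lift1 (z (Ordinal v0)) + a *: y
      = col_mx (z (Ordinal v0) + a *: u) (const_mx (1 + a * t)).
    by rewrite yE scale_col_mx add_col_mx; congr col_mx; apply/matrixP => k k'; rewrite !mxE.
  have := pos (z (Ordinal v0) + a *: u) (1 + a * t); rewrite -uE => Ha.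
  have {Ha} : 0 <= (c i *m (lift1 (z (Ordinal v0)) + a *: y)) 0 0.
    apply: Ha; first by rewrite ltr_pwDl// mulr_ge0.
    by rewrite mulmxDr -scalemxAr; apply: nonneg_mxD => //; exact: nonneg_mxZ.
  rewrite mulmxDr -scalemxAr mxE -/cz [X in _ + X]mxE.
  have -> : a * (c i *m y) 0 0 = - (cz + 1) by rewrite /a invrN mulrN mulNr divfK ?lt_eqF.
  lra.
have [v0|v0] := posnP v.
  apply: (@nonneg_rank_le _ _ _ _ _ 0 0); [exact: nonneg_mx0|exact: nonneg_mx0|].
  by apply/matrixP => i j; exfalso; have := ltn_ord j; rewrite [X in (_ < X)%N]v0.
have /choice[l lP] : forall i, exists l : 'rV[R]__, nonneg_mx l /\ c i = l *m H.
  by move=> i; have [l l0 lE] := farkas (fun y => key i y v0); exists l.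
(* [M] collects the Farkas multipliers and [Z] the points of the extension above the vertices. *)
pose M := \matrix_(i, a) l i 0 a; pose Z := \matrix_(a, j) z j a 0.
have MI i : row i M = l i by apply/rowP => a; rewrite !mxE.
have ZJ j : col j Z = z j by apply/colP => a; rewrite !mxE.
apply: (@nonneg_rank_le _ _ _ _ _ M (H *m lift1 Z)).
- by move=> i a; rewrite mxE; have [l0 _] := lP i; exact: l0.
- by move=> a j; rewrite -mul_colE col_lift1 ZJ; exact: Hz.
apply/matrixP => i j; rewrite -row_mulE MI mulmxA -(lP i).2 -mul_colE col_lift1 ZJ cE.
by rewrite (zP j).2 mxE.
Qed.

(* P is the projection of {(x, y) | y >= 0, C x - d = U y, A x = b}; passing to a
   row basis, n + rank_+ equations suffice. *)
Lemma ext_size_nonneg_rank :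
  (0 < v)%N -> ext_sizes P (nonneg_rank S + (n + nonneg_rank S) + (n + nonneg_rank S)).
Proof.
move=> v0; have Sge0 : nonneg_mx S := slack_ge0 Pb PV.
have [U [W [U0 W0 SE _ _]]] := nonneg_rank_factor Sge0.
move: U W U0 W0 SE; move: (nonneg_rank S) => k U W U0 W0 SE.
pose E0 := col_mx (row_mx C (- U)) (row_mx A 0); pose g0 := col_mx d b.
have E0P x y : E0 *m col_mx x y = g0 <-> C *m x = d + U *m y /\ A *m x = b.
  rewrite mul_col_mx !mul_row_col mul0mx addr0 mulNmx; split.
    by move=> /eq_col_mx[<- ->]; rewrite subrK.
  by move=> [-> ->]; rewrite addrK.
have lift_conv (l : 'cV[R]_v) : \sum_j l j 0 = 1 -> C *m (V *m l) = d + U *m (W *m l).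
  move=> l1; rewrite [U *m _]mulmxA -SE /S slackE -mulmxA lift1_mul l1 mul_row_col mulNmx.
  rewrite -[X in X = _](addNKr d); congr (_ + _).
  rewrite addrC; congr (_ - _); apply/colP => i; by rewrite !mxE big_ord1 mxE mulr1.
have PVE : P = conv V := polyhedron_conv_vertices Pb PV.
have Px x : P x -> exists2 y : 'cV[R]_k, nonneg_mx y & E0 *m col_mx x y = g0.
  move=> Px; have [_ Ax] := Px; rewrite PVE in Px; have [l [l0 l1 xE]] := Px.
  exists (W *m l); first exact: nonneg_mxM.
  by apply/E0P; split=> //; rewrite xE lift_conv.
have [y0 y00 E0z] := Px _ (vertex_in Pb PV (Ordinal v0)).
(* [E0] has too many rows; [<<E0>>%MS] has the same row space and n + k rows. The solution [z0],
   found above a vertex, provides the right-hand side. *)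
set z0 := col_mx _ _ in E0z; pose E : 'M_(n + k) := <<E0>>%MS.
have EP z : E *m z = E *m z0 <-> E0 *m z = g0.
  have /submxP[X XE] : (E0 <= E)%MS by rewrite genmxE.
  have /submxP[Y YE] : (E <= E0)%MS by rewrite genmxE.
  by split=> h; [rewrite XE -mulmxA h mulmxA -XE | rewrite YE -!mulmxA h E0z].
exists k, k, (n + k)%N, (row_mx 0 1%:M), 0, E, (E *m z0); split=> //.
have GP (x : 'cV[R]_n) (y : 'cV[R]_k) : row_mx 0 1%:M *m col_mx x y = y.
  by rewrite mul_row_col mul0mx mul1mx add0r.
apply/seteqP; split=> x.
  move=> /Px[y y0' Ey]; exists y; split; last exact/EP.
  by move=> i; rewrite GP mxE.
move=> [y [y0' /EP/E0P[Cx Ax]]]; split=> // i.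
have Uy : nonneg_mx (U *m y).
  by apply: nonneg_mxM => // a a'; have := y0' a; rewrite GP mxE ord1.
by rewrite Cx [leRHS]mxE lerDl.
Qed.

End Extension.

(** * The combined bounds and their constants *)

Theorem corollary4 (R : realType) :
  exists c1 c2 c3 c4 : R,
    [/\ 0 < c1, 0 < c2, 0 < c3 & 0 < c4] /\
    forall (n f m v r : nat)
           (C : 'M[R]_(f, n)) (d : 'cV[R]_f) (A : 'M[R]_(m, n)) (b : 'cV[R]_m)
           (V : 'M[R]_(n, v)),
      let P := polyhedron C d A b in
      let S := slack_matrix C d V in
      let rp := nonneg_rank S in
      let s := ext_complexity P in
      is_bounded P ->
      enumerates (vertices P) V ->
      \rank S = r ->
      (affdim P).+1 = r ->
      [/\ (v <= phi R r rp)%N,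
          (phi R r rp <= \max_(r <= ru < rp.+1) 'C(rp, ru - r + 1))%N,
          (\max_(r <= ru < rp.+1) 'C(rp, ru - r + 1) <= 'C(rp, rp./2))%N &
          ('C(rp, rp./2) <= 2 ^ rp)%N] /\
      ((0 < n)%N ->
        [/\ c1 * (rp + n)%:R <= s%:R,
            s%:R <= c2 * (rp + n)%:R,
            c3 * (phi_inv R r v)%:R <= s%:R &
            c4 * log2 (v%:R : R) <= (phi_inv R r v)%:R]).
Proof.
(* rp <= 2 s and n <= s give 3^-1; the explicit extension, of size 3 rp + 2 n, gives 3;
   [phi_inv R r v] <= rp <= 2 s gives 2^-1; and v <= 2 ^ [phi_inv R r v] gives 1. *)
exists 3^-1, 3, 2^-1, 1; split; first by rewrite !invr_gt0 ltr01 !ltr0n.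
move=> n f m v r C d A b V P S rp s Pb PV Sr Pr.
(* Since r is at least 1, the rank hypothesis excludes an empty P and a single point at which all
   inequalities are tight. *)
have S0 : S != 0 by apply/eqP => S0; move: Sr; rewrite S0 mxrank0 -Pr.
have v_phi : (v <= phi R r rp)%N by rewrite -Pr; exact: leq_vertices_phi Pb PV S0.
split.
  by split=> //; [exact: phi_le_bin | exact: bigmax_bin_le | exact: leq_bin_expn2].
move=> n0; have v0 : (0 < v)%N.
  by apply: leq_trans (rank_leq_col S); rewrite Sr -Pr.
have up := ext_size_nonneg_rank Pb PV v0.
have [sP smin] : ext_sizes P s /\ forall k, ext_sizes P k -> (s <= k)%N.
  by apply: nat_minP; eexists; exact: up.
have rps : (rp <= 2 * s)%N := nonneg_rank_le_ext_size Pb PV n0 sP.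
have ns : (n <= s)%N by have [p [q [e [_ [_ [_ [_ [_ ->]]]]]]]] := sP; lia.
have [inv_phi inv_min] : (v <= phi R r (phi_inv R r v))%N /\
    forall k, (v <= phi R r k)%N -> (phi_inv R r v <= k)%N.
  by apply: (@nat_minP [set k | (v <= phi R r k)%N]); exists rp.
have inv_le : (phi_inv R r v <= rp)%N by exact: inv_min.
split.
- rewrite mulrC ler_pdivrMr// -natrM ler_nat; apply: leq_trans (leq_add rps ns) _.
  by rewrite -mulSnr mulnC.
- rewrite -natrM ler_nat; apply: leq_trans (smin _ up) _.
  rewrite -/P -/S -/rp; move: (rp) => a; rewrite !mulSn mul0n addn0; clear; lia.
- rewrite mulrC ler_pdivrMr// -natrM ler_nat mulnC; exact: leq_trans inv_le rps.
rewrite mul1r ler_pdivrMr ?ln_gt0 ?ltr1n// mulr_natl -lnXn// ler_ln ?posrE ?exprn_gt0 ?ltr0n//.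
by rewrite -natrX ler_nat; exact: leq_trans inv_phi (phi_le_expn2 _ _ _).
Qed.
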